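(* Let $\mathcal{M}$ be any polyhedral structure of $\mathcal{M}_n$ (and hence a refinement of the combinatorial subdivision). Let $\tau\in\mathcal{M}$ be a $d$-dimensional cell. Let $C_\tau$ be the combinatorial type of a curve represented by a point in the relative interior of $\tau$. Denote by $p_1,\dots,p_k$ its vertices and by $l$ its number of bounded edges. Then $$\mathrm{Star}_{\mathcal{M}_n}(\tau)\cong\mathbb{R}^{l-d}\times\mathcal{M}_{\mathrm{val}(p_1)}\times\dots\times\mathcal{M}_{\mathrm{val}(p_k)}.$$
   Context: An $n$-marked rational tropical curve is a metric tree with $n$ unbounded edges (leaves) labelled $1,\dots,n$, all of whose vertices are at least trivalent. For such a curve $C$ let $d(C)\in\mathbb{R}^{\binom n2}$ be the vector of distances $d(C)_{i,j}$ ($i<j$) between leaves. With $\Phi_n:\mathbb{R}^n\to\mathbb{R}^{\binom n2}$, $a\mapsto(a_i+a_j)_{i<j}$, let $\mathcal{M}_n := \{d(C) : C\ n\text{-marked curve}\}\subseteq\mathbb{R}^{\binom n2}/\Phi_n(\mathbb{R}^n)$. It is a pure $(n-3)$-dimensional fan whose cones, in the combinatorial subdivision, correspond to combinatorial types of curves (curves up to forgetting the metric). The lattice $\Lambda$ is generated by the vectors $v_I$ of curves with exactly one bounded edge, of length 1, inducing the split $I|I^c$ of $\{1,\dots,n\}$. With weight 1 on each maximal cone, $\mathcal{M}_n$ is a tropical cycle. ($\mathcal{M}_3$ is a point.) For a cell $\tau$ of a polyhedral complex in a vector space $V$, let $V_\tau=\langle a-b : a,b\in\tau\rangle$, $\Lambda_\tau=V_\tau\cap\Lambda$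 and $\Pi:V\to V/V_\tau$ the quotient map. Then $\mathrm{Star}(\tau) := \{\mathbb{R}_{\ge0}\cdot\Pi(\sigma-\tau) : \tau<\sigma\}\cup\{0\}$ is a fan in $V/V_\tau$ (with lattice $\Lambda/\Lambda_\tau$), where the cone of a maximal cell $\sigma$ carries the weight of $\sigma$. In the claim $\mathrm{Star}_{\mathcal{M}_n}(\tau)$ is formed in the polyhedral structure $\mathcal{M}$. The symbol $\cong$ denotes isomorphism of tropical fan cycles, considered up to refinement of the polyhedral structure: a linear isomorphism between the linear spans of the two fans, compatible with their lattices, identifying supports and weights. The product of tropical cycles carries the product weights, and $\mathbb{R}^{l-d}$ has weight 1. *)

(* Defs.v *)
From HB Require Import structures.
From mathcomp Require Import all_boot all_order all_algebra.
From mathcomp Require Import boolp classical_sets cardinality reals.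

Set Implicit Arguments.
Unset Strict Implicit.
Unset Printing Implicit Defensive.

Import Order.TTheory GRing.Theory Num.Theory.

Local Open Scope ring_scope.

(** * Marked trees and marked rational tropical curves *)

(* [leaf i] is the vertex from which the unbounded edge labelled [i] emanates,
   so the valence counts bounded edges and leaves. *)
Definition graph_valence (n : nat) (T : finType) (adj : rel T) (leaf : 'I_n -> T)
    (p : T) : nat :=
  (#|[set q | adj p q]%SET| + #|[set i | leaf i == p]%SET|)%N.

Record combinatorial_type (n : nat) := CombinatorialType {
  vertex :> finType;
  adj : rel vertex;
  leaf : 'I_n -> vertex;
  adj_sym : symmetric adj;
  adj_irr : irreflexive adj;
  vertex_gt0 : (0 < #|vertex|)%N;
  adj_connected : forall u v : vertex, connect adj u v;
  adj_acyclic : forall c : seq vertex, ucycle adj c -> (size c <= 2)%N;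
  valence_ge3 : forall p : vertex, (3 <= graph_valence adj leaf p)%N }.

Arguments adj {n}.
Arguments leaf {n}.

Section Trees.
Variables (n : nat) (T : combinatorial_type n).

Definition valence (p : T) : nat := graph_valence (adj T) (leaf T) p.

Definition bounded_edges : {set {set T}} :=
  [set [set uv.1; uv.2]%SET | uv in [pred uv : T * T | adj T uv.1 uv.2]]%SET.

Lemma simple_path_exists (u v : T) : exists p : seq T,
  [&& path (adj T) u p, last u p == v & uniq (u :: p)].
Proof.
have /connectP[p pathp ->] := adj_connected u v.
by case/shortenP: pathp => p' pathp' uniqp' _; exists p'; rewrite pathp' eqxx.
Qed.

(* Without its starting point [u]; it is unique, since [T] is a tree. *)
Definition simple_path (u v : T) : seq T := xchoose (simple_path_exists u v).

End Trees.

Record curve (R : realType) (n : nat) := Curve {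
  curve_type :> combinatorial_type n;
  len : {set curve_type} -> R;
  len_gt0 : forall e, e \in bounded_edges curve_type -> 0 < len e }.

Section Distances.
Variables (R : realType) (n : nat).

Definition index_pair := {ij : 'I_n * 'I_n | (ij.1 < ij.2)%N}.

Definition pair_space : vectType R := {ffun index_pair -> R^o}.

Definition distance (T : combinatorial_type n) (l : {set T} -> R) (u v : T)
    : R :=
  \sum_(r <- pairmap (fun a b => l [set a; b]%SET) u (simple_path u v)) r.

(* The infinite lengths of the leaves are discarded: giving the leaves any
   finite lengths would change the vector by an element of the image of Phi. *)
Definition distance_vector (T : combinatorial_type n) (l : {set T} -> R)
    : pair_space :=
  [ffun ij : index_pair =>
    distance l (leaf T (sval ij).1) (leaf T (sval ij).2) : R^o].

Definition Phi_fun (a : 'rV[R]_n) : pair_space :=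
  [ffun ij : index_pair => a 0 (sval ij).1 + a 0 (sval ij).2 : R^o].

Lemma Phi_fun_linear : linear Phi_fun.
Proof.
move=> c a b; apply/ffunP => ij.
by rewrite !ffunE !mxE scalerDr addrACA.
Qed.

HB.instance Definition _ :=
  GRing.isLinear.Build R 'rV[R]_n pair_space _ Phi_fun Phi_fun_linear.

Definition Phi : 'Hom('rV[R]_n, pair_space) := linfun Phi_fun.

End Distances.

(** * Quotients of vector spaces *)

Section Quotient.
Variables (R : fieldType) (V : vectType R) (U : {vspace V}).

(* V / U, realised on the chosen complement U^C of U; [quotv_ker] and
   [quotv_img] are what makes it a quotient. *)
Definition quotv : Type := subvs_of (U^C)%VS.

HB.instance Definition _ := Vector.on quotv.

Definition quotv_pi : 'Hom(V, quotv) :=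
  (linfun (vsproj (U^C)%VS) \o daddv_pi (U^C)%VS U)%VF.

Let dUC : (U^C :&: U = 0)%VS.
Proof. by rewrite capvC capv_compl. Qed.

Lemma quotv_piE (v : V) : vsval (quotv_pi v) = daddv_pi (U^C)%VS U v.
Proof.
by rewrite /quotv_pi comp_lfunE lfunE /= vsprojK // memv_pi.
Qed.

Lemma quotv_ker : lker quotv_pi = U.
Proof.
have eq0 (w : quotv) : w = 0 <-> vsval w = 0.
  by split=> [-> //|w0]; apply: val_inj.
have dU : (U :&: U^C = 0)%VS by rewrite capv_compl.
apply/vspaceP => v; rewrite memv_ker.
have vT : v \in (U + U^C)%VS by rewrite addv_complf memvf.
have vE := daddv_pi_add dU vT.
apply/eqP/idP => [/eq0|vU]; last apply/eq0.
  by rewrite quotv_piE => v0; rewrite -vE v0 addr0 memv_pi.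
rewrite quotv_piE; apply: (addrI v); rewrite addr0.
by move: vE; rewrite (daddv_pi_id dU vU).
Qed.

Lemma quotv_img : limg quotv_pi = fullv.
Proof.
apply/vspaceP => w; rewrite memvf; apply/memv_imgP.
exists (vsval w); first exact: memvf.
suff E : vsval (quotv_pi (vsval w)) = vsval w by apply: val_inj.
by rewrite quotv_piE daddv_pi_id // subvsP.
Qed.

End Quotient.

Local Open Scope classical_set_scope.

(** * Polyhedra *)

Section Span.
Variables (R : fieldType) (V : vectType R).

Definition is_span (A : set V) (U : {vspace V}) :=
  (forall a, A a -> a \in U) /\
  (forall W : {vspace V}, (forall a, A a -> a \in W) -> (U <= W)%VS).

Definition span_set (A : set V) : {vspace V} := xget 0%VS (is_span A).

Lemma span_setP (A : set V) : is_span A (span_set A).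
Proof.
rewrite /span_set; case: xgetP => // noU; exfalso.
pose P k := `[< exists2 s : seq V, (forall a, a \in s -> A a)
                & \dim <<s>>%VS = k >].
have exP : exists k, P k.
  by exists 0%N; apply/asboolP; exists [::] => //; rewrite span_nil dimv0.
have bP k : P k -> (k <= \dim {:V})%N.
  by move=> /asboolP[s _ <-]; apply: dimvS; apply: subvf.
case: (ex_maxnP exP bP) => k /asboolP[s sA sk] kmax.
apply: (noU <<s>>%VS); split=> [a Aa|W AW]; last first.
  by apply/span_subvP => a /sA; apply: AW.
have sub : (<<s>> <= <<a :: s>>)%VS by rewrite span_cons addvSr.
have /kmax : P (\dim <<a :: s>>%VS).
  apply/asboolP; exists (a :: s) => // b.
  by rewrite inE => /orP[/eqP ->|/sA].
rewrite -sk => le; have /eqP -> : (<<s>> == <<a :: s>>)%VS.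
  by rewrite eqEdim sub.
by apply: memv_span; rewrite mem_head.
Qed.

End Span.

Section Polyhedra.
Variables (R : realType) (V : vectType R).

Definition zspan (G : set V) : set V :=
  [set v | exists s : seq (int * V),
     (forall x, x \in s -> G x.2) /\ v = \sum_(x <- s) x.2 *~ x.1].

Definition direction (sigma : set V) : {vspace V} :=
  span_set [set v | exists a b, sigma a /\ sigma b /\ v = a - b].

Definition dimension (sigma : set V) : nat := \dim (direction sigma).

(* Interior for the subspace topology of the affine hull x + direction sigma;
   neighbourhoods of 0 are taken in coordinates on V. *)
Definition relint (sigma : set V) : set V :=
  [set x | sigma x /\ exists2 e : R, 0 < e &
     forall v, v \in direction sigma ->
       (forall j, `|coord (vbasis {:V}) j v| < e) -> sigma (x + v)].

(* Rational slopes, arbitrary real constant terms. *)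
Definition rational_polyhedron (Lambda sigma : set V) : Prop :=
  sigma !=set0 /\
  exists s : seq ('Hom(V, R^o) * R),
    (forall fa, fa \in s -> forall v, Lambda v -> (fa.1 v : R) \is a Num.int) /\
    sigma = [set x | forall fa, fa \in s -> fa.2 <= fa.1 x].

Definition face (tau sigma : set V) : Prop :=
  tau !=set0 /\
  exists (f : 'Hom(V, R^o)) (a : R),
    (forall x, sigma x -> a <= f x) /\
    tau = sigma `&` [set x | f x = a].

Definition polyhedral_complex (Lambda : set V) (X : set (set V)) : Prop :=
  [/\ finite_set X,
      forall sigma, X sigma -> rational_polyhedron Lambda sigma,
      forall sigma tau, X sigma -> face tau sigma -> X tau
    & forall sigma tau, X sigma -> X tau -> sigma `&` tau !=set0 ->
        face (sigma `&` tau) sigma /\ face (sigma `&` tau) tau].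

Definition maximal_cell (X : set (set V)) (sigma : set V) : Prop :=
  X sigma /\ forall sigma', X sigma' -> sigma `<=` sigma' -> sigma' = sigma.

End Polyhedra.

(** * Weighted complexes *)

(* Only the weights of maximal cells are meaningful. *)
Record weighted_complex (R : realType) (V : vectType R) := WeightedComplex {
  cells :> set (set V);
  weight : set V -> int }.

Definition support (R : realType) (V : vectType R) (X : weighted_complex V)
    : set V :=
  \bigcup_(sigma in cells X) sigma.

Record fan (R : realType) := Fan {
  ambient : vectType R;
  lattice : set ambient;
  complex :> weighted_complex ambient }.

Arguments lattice {R}.

(* A linear map between the spans of the supports is the same as the
   restriction of a linear map between the ambient spaces.  The weights are
   compared at common relative interior points of maximal cells, so that the
   notion is insensitive to refinements. *)
Definition fan_iso (R : realType) (X Y : fan R) : Prop :=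
  exists f : 'Hom(ambient X, ambient Y),
    [/\ (lker f :&: span_set (support X) = 0)%VS,
        (f @: span_set (support X) = span_set (support Y))%VS,
        f @` (lattice X `&` [set` span_set (support X)])
          = lattice Y `&` [set` span_set (support Y)],
        f @` support X = support Y
      & forall sigma rho, maximal_cell X sigma -> maximal_cell Y rho ->
          (f @` relint sigma) `&` relint rho !=set0 ->
          weight X sigma = weight Y rho].

Definition fan_prod (R : realType) (X Y : fan R) : fan R :=
  @Fan R (ambient X * ambient Y)%type (lattice X `*` lattice Y)
    (WeightedComplex
      [set kappa | exists sigma rho,
         [/\ cells X sigma, cells Y rho & kappa = sigma `*` rho]]
      (fun kappa => weight X (fst @` kappa) * weight Y (snd @` kappa))).

Definition affine_space (R : realType) (m : nat) : fan R :=
  @Fan R 'rV[R]_m [set v | forall j, v 0 j \is a Num.int]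
    (WeightedComplex [set [set: 'rV[R]_m]] (fun=> 1)).

Section Star.
Variables (R : realType) (V : vectType R) (Lambda : set V).
Variables (X : weighted_complex V) (tau : set V).

Definition star_space : vectType R := quotv (direction tau).

Definition star_cone (sigma : set V) : set star_space :=
  [set w | exists c a b, [/\ 0 <= c, sigma a, tau b &
                           w = c *: quotv_pi (direction tau) (a - b)]].

(* The image of Lambda is Lambda / (Lambda `&` direction tau).  In a polyhedral
   complex distinct cells have distinct star cones, so the choice made in the
   weight is no choice; the maximal cell may be tau itself, with cone 0. *)
Definition Star : fan R :=
  @Fan R star_space (quotv_pi (direction tau) @` Lambda)
    (WeightedComplex
      ([set kappa | exists sigma, [/\ cells X sigma, face tau sigma,
                                     tau <> sigma & kappa = star_cone sigma]]
         `|` [set [set 0]])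
      (fun kappa => weight X (xget tau
        [set sigma | [/\ maximal_cell X sigma, face tau sigma
                       & kappa = star_cone sigma]]))).

End Star.

(** * The moduli space of n-marked rational tropical curves *)

Section Moduli.
Variables (R : realType) (n : nat).

Definition moduli_space : vectType R := quotv (limg (Phi R n)).

Definition class_of (T : combinatorial_type n) (l : {set T} -> R)
    : moduli_space :=
  quotv_pi (limg (Phi R n)) (distance_vector l).

Definition point_of (C : curve R n) : moduli_space := class_of (@len R n C).

Definition moduli_support : set moduli_space :=
  [set x | exists C : curve R n, x = point_of C].

Definition moduli_lattice : set moduli_space :=
  zspan [set v | exists C : curve R n,
    [/\ #|bounded_edges C| = 1%N,
        forall e, e \in bounded_edges C -> len e = 1
      & v = point_of C]].

(* Edges of length 0 stand for contracted edges, which yields the closed cone.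
   Intersecting with [moduli_support] removes nothing; it makes
   [support_moduli] immediate. *)
Definition moduli_cone (T : combinatorial_type n) : set moduli_space :=
  moduli_support `&`
  [set x | exists2 l : {set T} -> R,
     (forall e, e \in bounded_edges T -> 0 <= l e) & x = class_of l].

Definition moduli : fan R :=
  @Fan R moduli_space moduli_lattice
    (WeightedComplex
      [set kappa | exists T : combinatorial_type n, kappa = moduli_cone T]
      (fun=> 1)).

Lemma support_moduli : support moduli = moduli_support.
Proof.
apply/seteqP; split=> [x [_ [T ->] []]//|_ [C ->]].
exists (moduli_cone C); first by exists (C : combinatorial_type n).
split; first by exists C.
by exists (@len R n C) => // e /len_gt0/ltW.
Qed.

Definition moduli_structure (M : weighted_complex moduli_space) : Prop :=
  [/\ polyhedral_complex moduli_lattice M,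
      support M = moduli_support
    & forall sigma, maximal_cell M sigma -> weight M sigma = 1].

End Moduli.

(* Main.v *)
From HB Require Import structures.
Require Import Defs.
From mathcomp Require Import all_boot all_order all_algebra.
From mathcomp Require Import zify ring lra.
From mathcomp Require Import boolp classical_sets cardinality reals.

Set Implicit Arguments.
Unset Strict Implicit.
Unset Printing Implicit Defensive.
Import Order.TTheory GRing.Theory Num.Theory.

(** Let [x] be the point of the curve [C] and [T] its tree.  The star of [tau]
    is the local cone of the moduli space at [x] (the directions in which one
    can leave [x] without leaving the support) modulo the directions of [tau]
    ([star_support]); this does not depend on the polyhedral structure, which
    is why any structure is allowed.

    The local cone is computed from the four-point condition.  A vector of
    pairs comes, up to the image of [Phi], from a metric tree if and only if
    among the three sums [v_ij + v_kl], [v_ik + v_jl], [v_il + v_jk] the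
    maximum is always attained twice ([distance_four_point] and
    [four_point_support]; the converse builds the tree of balls of an
    ultrametric).  Near [x] this splits into two kinds of conditions.  If an
    edge of [T] separates [ij] from [kl], then at [x] one sum is strictly
    smaller than the two others, and a small perturbation [v] only has to
    keep these two equal, which is a linear equation ([tangent]).  If no edge
    separates the four leaves two against two, then they leave some vertex
    [p] in four different directions ([unresolved_vertex]), all three sums
    agree at [x], and [v] has to satisfy the four-point condition itself.
    The latter conditions concern only the restriction of [v] to one leaf in
    each direction at [p]: they say that this restriction belongs to the
    moduli space with [valence p] leaves ([local_four_pointP]).

    So the local cone is read off from the map that sends a tangent vector to
    its edge coordinates, one for each bounded edge, and to its restrictions
    at all vertices.  This map is bijective from the tangent vectors onto the
    product ([local_lift], [local_injective]).  Surjectivity is by gluing.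
    For injectivity, a vector with trivial restriction at [p] is a potential
    [a i + a j] across [p]; the coordinate of an edge compares the potentials
    at its ends, and if all of these agree, the vector lies in the image of
    [Phi].  The lattices correspond as well, because the lattice of the moduli
    space consists of the classes of vectors with even integral entries
    ([lattice_even], [even_lattice]).

    Finally a direction of [tau] is a line in the local cone, and the moduli
    spaces of the vertices contain no lines ([four_point_pointed]); hence the
    directions of [tau] are a subspace of the space of edge lengths.  It is
    cut out by integral equations, so the Smith normal form provides integral
    coordinates on the quotient ([rational_coords]), which is the first factor
    of the product.  All weights are 1. *)

(** * Bridges in a connected graph *)

Section Bridges.
Variables (X : finType) (e : rel X).

Definition without (E : {set X}) : rel X := [rel x y | e x y && ([set x; y]%SET != E)].

Definition side (p q : X) : pred X := connect (without [set p; q]%SET) q.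

Definition separated (E : {set X}) (u v : X) : bool := ~~ connect (without E) u v.

Hypothesis esym : symmetric e.

Lemma without_sym E : symmetric (without E).
Proof. by move=> x y; rewrite /without /= esym finset.setUC. Qed.

Lemma without_connect_sym E : connect_sym (without E).
Proof. exact/sym_connect_sym/without_sym. Qed.

Lemma set2_cases (u v p q : X) : [set u; v]%SET = [set p; q]%SET ->
  (u = p /\ v = q) \/ (u = q /\ v = p).
Proof.
move=> E.
have up : u \in [set p; q]%SET by rewrite -E set21.
have vp : v \in [set p; q]%SET by rewrite -E set22.
have pu : p \in [set u; v]%SET by rewrite E set21.
have qu : q \in [set u; v]%SET by rewrite E set22.
move: up vp pu qu; rewrite !inE.
case/orP => /eqP ->; case/orP => /eqP ->; rewrite ?eqxx ?orbb /=; try by [left|right].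
- by move=> _ /eqP ->; left.
- by move=> /eqP -> _; left.
Qed.

Lemma side_invariant (phi : X -> bool) E u v :
  (forall x y, e x y -> [set x; y]%SET != E -> phi x = phi y) ->
  connect (without E) u v -> phi u = phi v.
Proof.
move=> inv /connectP[s]; elim: s u => [u _ -> //|w s IH] u /= /andP[/andP[euw nE] ps] lv.
by rewrite (inv u w) // (IH w).
Qed.

Lemma sidexx p q : side p q q.
Proof. exact: connect0. Qed.

Lemma side_adj p q x y :
  e x y -> [set x; y]%SET != [set p; q]%SET -> side p q x = side p q y.
Proof.
move=> exy nE; rewrite /side; apply: same_connect_r; first exact: without_connect_sym.
by apply: connect1; rewrite /without /= exy.
Qed.

Lemma sep_sym E u v : separated E u v = separated E v u.
Proof. by rewrite /separated without_connect_sym. Qed.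

Hypothesis econn : forall u v, connect e u v.

(** This replaces arguments with paths: two sides of edges are shown to be
    disjoint or nested by exhibiting a set that no edge leaves and that misses
    some vertex, hence is empty. *)
Lemma closed_full (A : pred X) u v :
  (forall x y, A x -> e x y -> A y) -> A u -> A v.
Proof.
move=> cl; case/connectP: (econn u v) => s; elim: s u => [u _ -> //|w s IH] u /= /andP[euw ps] lv Au.
by apply: (IH w) => //; apply: cl euw.
Qed.

Hypothesis bridge : forall p q, e p q -> ~~ connect (without [set p; q]%SET) p q.

Lemma sidex p q : e p q -> side p q p = false.
Proof. by move=> epq; apply: negbTE; rewrite /side without_connect_sym bridge. Qed.

Lemma bridged_irr p : e p p = false.
Proof. by apply/negP => /bridge; rewrite connect0. Qed.

(** Every vertex is on some side, as both ends of the edge are; nothing is on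
    both sides, as the edge is a bridge. *)
Lemma sideC p q u : e p q -> side q p u = ~~ side p q u.
Proof.
move=> epq; apply/idP/idP.
  rewrite /side finset.setUC => pu; apply/negP => qu.
  have := bridge epq; rewrite (connect_trans pu) //.
  by rewrite without_connect_sym.
have cl : side q p u || side p q u.
  apply: (closed_full (A := fun x => side q p x || side p q x) (u := q)) => [x y xs exy|];
    last by rewrite sidexx orbT.
  have [E|nE] := eqVneq [set x; y]%SET [set p; q]%SET.
    by case: (set2_cases E) => -[_ ->]; rewrite sidexx ?orbT.
  rewrite -(side_adj exy nE) -(@side_adj q p x y) //.
  by rewrite (finset.setUC [set q]%SET).
by case/orP: cl => // ->.
Qed.

Lemma sep_side p q u v : e p q -> separated [set p; q]%SET u v = (side p q u != side p q v).
Proof.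
move=> epq; rewrite /separated; congr (~~ _); apply/idP/eqP => [|E].
  by apply: side_invariant => x y; apply: side_adj.
have [qu|nqu] := boolP (side p q u).
  have qv : side p q v by rewrite -E.
  by apply: connect_trans qv; rewrite without_connect_sym.
have pu : side q p u by rewrite sideC.
have pv : side q p v by rewrite sideC // -E.
move: pu pv; rewrite /side finset.setUC => pu pv.
by apply: connect_trans pv; rewrite without_connect_sym.
Qed.

(** This computes a side without looking at paths. *)
Lemma side_char (phi : X -> bool) p q : e p q ->
  (forall x y, e x y -> [set x; y]%SET != [set p; q]%SET -> phi x = phi y) ->
  phi q -> ~~ phi p -> side p q =1 phi.
Proof.
move=> epq inv phiq phip u; have [qu|nqu] := boolP (side p q u).
  by rewrite -(side_invariant inv qu) phiq.
have : side q p u by rewrite sideC.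
rewrite /side finset.setUC => /(side_invariant inv) <-.
by rewrite (negbTE phip).
Qed.

(** The neighbour of [p] in the direction of [u]; the value at [u = p] is
    a dummy. *)
Definition dir (p u : X) : X := odflt p [pick q | e p q && side p q u].

(** Together with [p] itself, the vertices beyond some neighbour of [p] form a
    set that no edge leaves. *)
Lemma dir_ex p u : u != p -> e p (dir p u) && side p (dir p u) u.
Proof.
move=> nup; rewrite /dir; case: pickP => //= noq; exfalso.
have: [exists q, e p q && side p q u] || (u == p).
  apply: (closed_full (A := fun x => [exists q, e p q && side p q x] || (x == p)) (u := p));
    last by rewrite eqxx orbT.
  move=> x y /orP[/existsP[q /andP[epq qx]]|/eqP ->] exy.
    have [E|nE] := eqVneq [set x; y]%SET [set p; q]%SET.
      case: (set2_cases E) => -[xE yE]; last by rewrite yE eqxx orbT.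
      by move: qx; rewrite xE sidex.
    by apply/orP; left; apply/existsP; exists q; rewrite epq -(side_adj exy nE).
  by apply/orP; left; apply/existsP; exists y; rewrite exy sidexx.
rewrite (negbTE nup) orbF => /existsP[q]; by rewrite noq.
Qed.

(** The intersection could only be left through [p], which lies in neither
    side. *)
Lemma side_disjoint p q r u : e p q -> e p r -> q != r -> side p q u -> side p r u -> False.
Proof.
move=> epq epr nqr pqu pru.
have nE : [set p; q]%SET != [set p; r]%SET.
  apply/eqP => E; case: (set2_cases E) => -[pE qE]; first by rewrite qE eqxx in nqr.
  by move: epq; rewrite qE bridged_irr.
have nq : ~~ side p r q by rewrite -(side_adj epq nE) sidex.
have nr : ~~ side p q r by rewrite -(side_adj epr) ?sidex // eq_sym.
have : side p q p && side p r p.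
  apply: (closed_full (A := fun x => side p q x && side p r x) (u := u));
    last by rewrite pqu.
  move=> x y /andP[qx rx] exy.
  have [E|n1] := eqVneq [set x; y]%SET [set p; q]%SET.
    case: (set2_cases E) => -[xE yE]; first by move: qx; rewrite xE sidex.
    by move: rx; rewrite xE (negbTE nq).
  have [E|n2] := eqVneq [set x; y]%SET [set p; r]%SET.
    case: (set2_cases E) => -[xE yE]; first by move: qx; rewrite xE sidex.
    by move: qx; rewrite xE (negbTE nr).
  by rewrite -(side_adj exy n1) -(side_adj exy n2) qx.
by rewrite sidex.
Qed.

Lemma dir_side p q u : e p q -> side p q u -> dir p u = q.
Proof.
move=> epq qu; have nup : u != p.
  by apply: contraTneq qu => ->; rewrite sidex.
have /andP[ed sd] := dir_ex nup.
by apply/eqP; apply: contraT => ne; case: (side_disjoint ed epq ne sd qu).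
Qed.

Lemma sideE p q u : e p q -> side p q u = (u != p) && (dir p u == q).
Proof.
move=> epq; apply/idP/andP => [qu|[/dir_ex/andP[_ su] /eqP <-//]].
rewrite (dir_side epq qu) eqxx; split=> //.
by apply: contraTneq qu => ->; rewrite sidex.
Qed.

(** What lies beyond [r], seen from [q], does not contain [p], so it cannot
    leave the branch at [p] to which [q] belongs. *)
Lemma dir_beyond p q r u : e q r -> ~~ side q r p -> p != q ->
  side q r u -> dir p u = dir p q.
Proof.
move=> eqr npr npq qru.
have /andP[eps psq] : e p (dir p q) && side p (dir p q) q by apply: dir_ex; rewrite eq_sym.
set s := dir p q in eps psq *.
have psr : side p s r.
  rewrite -(side_adj eqr) //; apply/eqP => /set2_cases[][qE rE].
    by rewrite qE eqxx in npq.
  by rewrite -rE sidexx in npr.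
apply: dir_side => //; rewrite -[_ u]negbK; apply/negP => npsu.
have : side q r p && ~~ side p s p.
  apply: (closed_full (A := fun x => side q r x && ~~ side p s x) (u := u));
    last by rewrite qru.
  move=> x y /andP[qx nx] exy.
  have [E|n1] := eqVneq [set x; y]%SET [set q; r]%SET.
    case: (set2_cases E) => -[xE yE]; first by move: qx; rewrite xE sidex.
    by move: nx; rewrite xE psr.
  have [E|n2] := eqVneq [set x; y]%SET [set p; s]%SET.
    case: (set2_cases E) => -[xE yE]; first by move: qx; rewrite xE (negbTE npr).
    by move: nx; rewrite xE sidexx.
  by rewrite -(side_adj exy n1) -(side_adj exy n2) qx.
by rewrite (negbTE npr).
Qed.

(** Compatibility of the splits of two edges: each edge lies on one side of the
    other, and the quadrant formed by the two remaining sides cannot be left by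
    any edge. *)
Lemma crossing p q p' q' : e p q -> e p' q' ->
  exists b b', forall u, ~~ ((side p q u == b) && (side p' q' u == b')).
Proof.
move=> epq epq'.
have [E|nE] := eqVneq [set p; q]%SET [set p'; q']%SET.
  case: (set2_cases E) => -[pE qE].
    by exists true; exists false => u; rewrite -pE -qE; case: (side p q u).
  by exists true; exists true => u; rewrite -pE -qE (@sideC p q u epq); case: (side p q u).
exists (~~ side p q p').
exists (~~ side p' q' p).
move=> u.
apply/negP.
move=> Au.
have : (side p q p == ~~ side p q p') && (side p' q' p == ~~ side p' q' p).
  apply: (closed_full (A := fun u => (side p q u == ~~ side p q p') && (side p' q' u == ~~ side p' q' p)) (u := u)) => //.
  move=> x y /andP[A1 A2] exy.
  have [F|n1] := eqVneq [set x; y]%SET [set p; q]%SET.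
    move: A2; case: (set2_cases F) => -[xE yE]; rewrite xE.
      by case: (side p' q' p).
    by rewrite -(side_adj epq nE); case: (side p' q' p).
  have [F|n2] := eqVneq [set x; y]%SET [set p'; q']%SET.
    rewrite eq_sym in nE.
    move: A1; case: (set2_cases F) => -[xE yE]; rewrite xE.
      by case: (side p q p').
    by rewrite -(side_adj epq' nE); case: (side p q p').
  by rewrite -(side_adj exy n1) -(side_adj exy n2) A1.
by case: (side p q p'); case: (side p' q' p); rewrite ?andbF.
Qed.

Local Open Scope ring_scope.

(** A simple path uses an edge at most once, and does so exactly when the edge
    separates its ends.  The path disappears from the right-hand side. *)
Lemma path_length (V : nmodType) (l : {set X} -> V) u s :
  path e u s -> uniq (u :: s) ->
  \sum_(r <- pairmap (fun a b => l [set a; b]%SET) u s) r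
    = \sum_(E in [set [set uv.1; uv.2]%SET | uv in [pred uv : X * X | e uv.1 uv.2]]%SET)
        l E *+ separated E u (last u s).
Proof.
elim: s u => [u _ _|w s IH u] /=.
  by rewrite big_nil big1 // => E _; rewrite /separated connect0 mulr0n.
move=> /andP[euw ps] /and3P[nu nw us].
rewrite big_cons IH //=; last by rewrite nw us.
set EE := [set _ | _ in _]%SET.
have EE0 : [set u; w]%SET \in EE.
  by apply/imsetP; exists (u, w) => //; rewrite inE.
rewrite (bigD1 [set u; w]%SET) //= [in RHS](bigD1 [set u; w]%SET) //=.
have wv : side u w (last w s).
  apply/connectP; exists s => //.
  have : all (fun x => x != u) (w :: s).
    by apply/allP => x xs; apply: contraNneq nu => <-.
  have gen t x : path e x t -> all (fun y => y != u) (x :: t) -> path (without [set u; w]%SET) x t.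
    elim: t x => //= y t IHt x /andP[exy pt] /and3P[nx ny nt].
    rewrite IHt //= ?ny // andbT /without /= exy /=; apply/eqP => /set2_cases[][xE yE].
      by rewrite xE eqxx in nx.
    by rewrite yE eqxx in ny.
  exact: gen.
have -> : separated [set u; w]%SET w (last w s) = false by apply/negbTE; rewrite negbK.
have -> : separated [set u; w]%SET u (last w s) = true by rewrite sep_side // wv sidex.
rewrite mulr0n add0r mulr1n; congr (_ + _).
apply: eq_bigr => E /andP[_ nE]; congr (_ *+ ~~ _).
apply: (same_connect (without_connect_sym E)); apply: connect1.
by rewrite /without /= esym euw finset.setUC eq_sym.
Qed.

End Bridges.

(** * Trees with marked leaves *)

Lemma graph_valenceE n (V : finType) (adj : rel V) (leaf : 'I_n -> V) (p : V) :
  graph_valence adj leaf p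
    = #|[set x : V + 'I_n | match x with inl q => adj p q | inr i => leaf i == p end]%SET|.
Proof.
rewrite /graph_valence -!sum1_card [RHS]big_sumType /=.
by congr (_ + _)%N; apply: eq_bigl => x; rewrite !inE.
Qed.

Section MarkedTree.
Variables (n : nat) (T : combinatorial_type n).

(** A path around an edge would close up to a cycle of length at least three. *)
Lemma adj_bridge (p q : T) : adj T p q ->
  ~~ connect (without (adj T) [set p; q]%SET) p q.
Proof.
move=> apq; apply/negP => /connectP[s0 ps0 lq].
case: (shortenP ps0) lq => s ps us _ lq.
have pa : path (adj T) p s by apply: sub_path ps => x y /andP[].
have uc : ucycle (adj T) (p :: s).
  by rewrite /ucycle us andbT /= rcons_path pa /= -lq adj_sym.
have := adj_acyclic uc.
case: s ps us {pa uc} lq => [|x [|//]] /= ps us E _.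
  by move: apq; rewrite E adj_irr.
by move: ps; rewrite E /without /= eqxx andbF.
Qed.

(** The leaves are made vertices, so that the bounded edges and the leaves at a
    vertex are treated alike: both are edges of this larger tree. *)
Definition xadj : rel (T + 'I_n) := fun x y =>
  match x, y with
  | inl u, inl v => adj T u v
  | inl u, inr i | inr i, inl u => leaf T i == u
  | inr _, inr _ => false
  end.

Definition root_of (x : T + 'I_n) : T :=
  match x with inl u => u | inr i => leaf T i end.

Lemma xadj_sym : symmetric xadj.
Proof. by move=> [u|i] [v|j] //=; apply: adj_sym. Qed.

Lemma xadj_connected x y : connect xadj x y.
Proof.
have csym : connect_sym xadj by apply/sym_connect_sym/xadj_sym.
have cinl (u v : T) : connect xadj (inl u) (inl v).
  case/connectP: (adj_connected u v) => s; elim: s u => [u _ ->|w s IH u] /=.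
    exact: connect0.
  by move=> /andP[auw ps] lv; apply: connect_trans (IH w ps lv); apply: connect1.
have croot z : connect xadj z (inl (root_of z)).
  by case: z => [u|i] /=; [exact: connect0 | apply: connect1; rewrite /=].
apply: connect_trans (croot x) _; apply: connect_trans (cinl _ (root_of y)) _.
by rewrite csym.
Qed.

Lemma inl_set2_neq (x y u v : T) :
  [set inl x; inl y]%SET != [set inl u; inl v]%SET :> {set T + 'I_n} ->
  [set x; y]%SET != [set u; v]%SET.
Proof.
apply: contraNneq => /set2_cases[][-> ->] //; by rewrite finset.setUC.
Qed.

Lemma side_root_of (u v : T) x y : xadj x y ->
  [set x; y]%SET != [set inl u; inl v]%SET ->
  side (adj T) u v (root_of x) = side (adj T) u v (root_of y).
Proof.
case: x y => [x|i] [y|j] //=; last 2 first.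
- by move/eqP ->.
- by move/eqP ->.
move=> axy /inl_set2_neq nE; apply: side_adj => //; exact: (@adj_sym _ T).
Qed.

Lemma leaf_edge_char (i : 'I_n) x y : xadj x y ->
  [set x; y]%SET != [set inl (leaf T i); inr i]%SET -> (x == inr i) = (y == inr i).
Proof.
move=> axy nE; apply/idP/idP => /eqP E; move: axy nE; rewrite E.
  by case: y {E} => //= u /eqP ->; rewrite finset.setUC eqxx.
by case: x {E} => //= u /eqP ->; rewrite eqxx.
Qed.

(** For a bounded edge, colour a leaf like the vertex that carries it; for the
    edge of a leaf, colour that leaf against all the rest. *)
Lemma xadj_bridge x y : xadj x y -> ~~ connect (without xadj [set x; y]%SET) x y.
Proof.
case: x y => [u|i] [v|j] //= axy; apply/negP.
- move/(side_invariant (@side_root_of u v)) => /=.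
  rewrite sidexx sidex //; [exact: (@adj_sym _ T) | exact: adj_bridge].
- by move/eqP: axy => <- /(side_invariant (@leaf_edge_char j)); rewrite eqxx.
- by move/eqP: axy => <-; rewrite finset.setUC => /(side_invariant (@leaf_edge_char i)); rewrite eqxx.
Qed.

Notation xside := (side xadj).

Lemma xside_root (u v : T) x : adj T u v ->
  xside (inl u) (inl v) x = side (adj T) u v (root_of x).
Proof.
move=> auv; apply: (side_char xadj_sym xadj_connected xadj_bridge
  (phi := fun z => side (adj T) u v (root_of z))) => //=.
- by move=> z w; apply: side_root_of.
- exact: sidexx.
- by rewrite sidex //; [exact: (@adj_sym _ T) | exact: adj_bridge].
Qed.

Lemma valenceE (p : T) : valence p = #|[set x | xadj (inl p) x]%SET|.
Proof. exact: graph_valenceE. Qed.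

Definition nbr (p : T) (a : 'I_(valence p)) : T + 'I_n :=
  enum_val (cast_ord (valenceE p) a).

Lemma nbr_adj (p : T) a : xadj (inl p) (nbr (p := p) a).
Proof. by have := enum_valP (cast_ord (valenceE p) a); rewrite inE. Qed.

Lemma nbr_inj (p : T) : injective (@nbr p).
Proof. by move=> a b /enum_val_inj/cast_ord_inj. Qed.

Lemma nbr_ex (p : T) x : xadj (inl p) x -> exists a, nbr (p := p) a == x.
Proof.
move=> ax; have xin : x \in [set x | xadj (inl p) x]%SET by rewrite inE.
exists (cast_ord (esym (valenceE p)) (enum_rank_in xin x)).
by rewrite /nbr cast_ordKV enum_rankK_in.
Qed.

Notation xdir := (dir xadj).

Lemma xdir_leaf (p : T) (i : 'I_n) :
  xadj (inl p) (xdir (inl p) (inr i)) && xside (inl p) (xdir (inl p) (inr i)) (inr i).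
Proof. exact: (dir_ex xadj_sym xadj_connected xadj_bridge). Qed.

Lemma ldir_subproof (p : T) (i : 'I_n) : exists a, nbr (p := p) a == xdir (inl p) (inr i).
Proof. by apply: nbr_ex; case/andP: (xdir_leaf p i). Qed.

(** Directions at [p] are numbered by ['I_(valence p)], the marks of the moduli
    space that belongs to [p]. *)
Definition ldir (p : T) (i : 'I_n) : 'I_(valence p) := sval (cid (ldir_subproof p i)).

Lemma nbr_ldir p i : nbr (ldir p i) = xdir (inl p) (inr i).
Proof. exact/eqP/(svalP (cid (ldir_subproof p i))). Qed.

Lemma ldir_eq p a i : (ldir p i == a) = xside (inl p) (nbr a) (inr i).
Proof.
rewrite (sideE xadj_sym xadj_connected xadj_bridge) ?nbr_adj //=.
by rewrite -nbr_ldir (inj_eq (@nbr_inj p)).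
Qed.

Lemma leaf_side (p : T + 'I_n) i x : xadj p (inr i) -> xside p (inr i) x = (x == inr i).
Proof.
move=> api; apply: (side_char xadj_sym xadj_connected xadj_bridge (phi := fun x => x == inr i)) => //.
- move=> y z ayz nE; apply: leaf_edge_char => //.
  by move: api nE; case: p => //= u /eqP ->.
- by case: p api.
Qed.

Lemma ldir_leaf (i j : 'I_n) : i != j -> ldir (leaf T i) i != ldir (leaf T i) j.
Proof.
move=> ij; have api : xadj (inl (leaf T i)) (inr i) by rewrite /=.
have ni : nbr (ldir (leaf T i) i) = inr i.
  by rewrite nbr_ldir; apply: (dir_side xadj_sym xadj_connected xadj_bridge api); apply: sidexx.
by rewrite eq_sym ldir_eq ni leaf_side // eq_sym; apply: contraNneq ij => -[->].
Qed.

Lemma third_nbr (p x y : T + 'I_n) : (if p is inl _ then true else false) ->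
  exists z, [/\ xadj p z, z != x & z != y].
Proof.
case: p => // p _; have := valence_ge3 p; rewrite -/(valence p) valenceE => ge3.
have : (0 < #|[set z | xadj (inl p) z] :\ x :\ y|)%SET.
  have := cardsD1 x [set z | xadj (inl p) z]%SET.
  have := cardsD1 y ([set z | xadj (inl p) z] :\ x)%SET.
  move: ge3; case: (_ \in _); case: (_ \in _); move=> /= + E1 E2; rewrite E2 E1; lia.
by case/card_gt0P => z; rewrite !inE => /and3P[? ? ?]; exists z.
Qed.

(** Sides shrink when one walks away from [p]. *)
Lemma beyond_sub p q r u : xadj p q -> xadj q r -> r != p -> xside q r u -> xside p q u.
Proof.
move=> apq aqr nrp sru.
have npq : p != q by apply: contraTneq apq => ->; rewrite (bridged_irr xadj_bridge).
have nside : ~~ xside q r p.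
  apply/negP => s1; apply: (side_disjoint xadj_sym xadj_connected xadj_bridge (p := q) aqr _ nrp s1).
    by rewrite xadj_sym.
  exact: sidexx.
rewrite (sideE xadj_sym xadj_connected xadj_bridge) //.
rewrite (dir_beyond xadj_sym xadj_connected xadj_bridge aqr nside npq sru).
rewrite (dir_side xadj_sym xadj_connected xadj_bridge apq (sidexx _ _ _)) eqxx andbT.
by apply: contraTneq sru => ->.
Qed.

Lemma side_card_lt p q r : xadj p q -> xadj q r -> r != p ->
  (#|xside q r| < #|xside p q|)%N.
Proof.
move=> apq aqr nrp; apply: proper_card; apply/properP; split.
  by apply/fintype.subsetP => u; apply: beyond_sub.
exists q; first exact: sidexx.
by apply/negbT/(sidex xadj_sym xadj_bridge).
Qed.

(** Walk away from [p]: as valences are at least three there is always a way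
    on, and since the sides shrink the walk ends, necessarily in a leaf. *)
Lemma leaf_beyond p q : xadj p q -> exists i, xside p q (inr i).
Proof.
move: {2}_.+1 (ltnSn #|xside p q|) => m; elim: m p q => // m IH p q le apq.
case: q apq le => [q|i] apq le; last by exists i; apply: sidexx.
have [//|r [aqr nrp _]] := @third_nbr (inl q) p p.
have [||i si] := IH (inl q) r => //.
  by rewrite ltnS in le; apply: leq_trans le; apply: side_card_lt.
by exists i; apply: beyond_sub si.
Qed.

Lemma rep_subproof (p : T) (a : 'I_(valence p)) : exists i, ldir p i == a.
Proof.
have [i si] := leaf_beyond (nbr_adj a); exists i; by rewrite ldir_eq.
Qed.

(** Restricting a vector to these leaves will keep all that matters at [p]: leaves
    in a common direction are interchangeable there ([direction_offset]). *)
Definition rep (p : T) (a : 'I_(valence p)) : 'I_n := sval (cid (rep_subproof a)).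

Lemma repK (p : T) : cancel (@rep p) (ldir p).
Proof. by move=> a; apply/eqP/(svalP (cid (rep_subproof a))). Qed.

Lemma rep_inj (p : T) : injective (@rep p).
Proof. exact: can_inj (@repK p). Qed.

(** Each of two vertices sees the other in one direction; a leaf in any other
    direction at [q] is seen from [p] in the direction of [q]. *)
Lemma ldir_other (p q : T) : p != q ->
  exists a b, forall i, ldir q i != b -> ldir p i = a.
Proof.
move=> npq.
have npq' : inl q != inl p :> T + 'I_n by apply: contraNneq npq => -[->].
have nqp' : inl p != inl q :> T + 'I_n by rewrite eq_sym.
have /andP[ap _] := dir_ex xadj_sym xadj_connected xadj_bridge npq'.
have /andP[aq sq] := dir_ex xadj_sym xadj_connected xadj_bridge nqp'.
have [a /eqP aE] := nbr_ex ap.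
have [b /eqP bE] := nbr_ex aq.
exists a; exists b => i nb; apply: nbr_inj; rewrite nbr_ldir aE.
have /andP[ar sr] := xdir_leaf q i.
apply: (dir_beyond xadj_sym xadj_connected xadj_bridge ar _ nqp' sr).
apply/negP => sp; have E := dir_side xadj_sym xadj_connected xadj_bridge ar sp.
by case/negP: nb; apply/eqP/nbr_inj; rewrite nbr_ldir bE E.
Qed.

Definition splits (E : {set T}) (i j : 'I_n) : bool := separated (adj T) E (leaf T i) (leaf T j).

Lemma bounded_edgeP (E : {set T}) :
  reflect (exists p q, adj T p q /\ E = [set p; q]%SET) (E \in bounded_edges T).
Proof.
apply: (iffP imsetP) => [[[p q]]|[p [q [apq ->]]]].
  by rewrite inE /= => apq ->; exists p; exists q.
by exists (p, q).
Qed.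

Lemma splitsE (p q : T) i j : adj T p q ->
  splits [set p; q]%SET i j =
  (xside (inl p) (inl q) (inr i) != xside (inl p) (inl q) (inr j)).
Proof.
move=> apq; rewrite /splits !xside_root //.
by apply: (sep_side (@adj_sym _ T) (@adj_connected _ T) (@adj_bridge)).
Qed.

Lemma splits_fun (E : {set T}) : E \in bounded_edges T ->
  exists phi : 'I_n -> bool, forall i j, splits E i j = (phi i != phi j).
Proof.
case/bounded_edgeP => p [q [apq ->]]; exists (fun i => xside (inl p) (inl q) (inr i)) => i j.
exact: splitsE.
Qed.

(** The colouring [f] by the sides of [E] is the same for all [p]; whatever is
    on the side of [E] away from [p] is seen from [p] in one direction. *)
Lemma edge_direction (E : {set T}) : E \in bounded_edges T ->
  exists f : T -> bool,
    [/\ forall i j, splits E i j = (f (leaf T i) != f (leaf T j)),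
        forall x y, adj T x y -> [set x; y]%SET != E -> f x = f y &
        forall p, exists a : 'I_(valence p),
          forall i, f (leaf T i) != f p -> ldir p i = a].
Proof.
case/bounded_edgeP => x [y [axy ->]]; exists (side (adj T) x y); split.
- by move=> i j; rewrite splitsE // !xside_root.
- by move=> u w auw nE; apply: side_adj => //; apply: (@adj_sym _ T).
suff gen (u w p : T) : adj T u w -> ~~ xside (inl u) (inl w) (inl p) ->
    exists a : 'I_(valence p), forall i, xside (inl u) (inl w) (inr i) -> ldir p i = a.
  move=> p; have ayx : adj T y x by rewrite adj_sym.
  have [sp|nsp] := boolP (xside (inl x) (inl y) (inl p)).
    have [|a aP] := gen y x p ayx.
      by rewrite (sideC xadj_sym xadj_connected xadj_bridge) ?negbK.
    exists a => i; move: sp; rewrite xside_root //= => ->; rewrite eqb_id => nsi; apply: aP.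
    by rewrite (sideC xadj_sym xadj_connected xadj_bridge) // xside_root.
  have [a aP] := gen x y p axy nsp.
  exists a => i; move: nsp; rewrite xside_root //= => /negbTE ->; rewrite eqbF_neg negbK => si.
  by apply: aP; rewrite xside_root.
move=> auw nsp; have [E'|nup] := eqVneq u p.
  subst p; have /nbr_ex[a /eqP aE] : xadj (inl u) (inl w) by [].
  by exists a => i si; apply/eqP; rewrite ldir_eq aE.
have nup' : inl u != inl p :> T + 'I_n by apply: contraNneq nup => -[->].
have /andP[ap _] := dir_ex xadj_sym xadj_connected xadj_bridge nup'.
have [a /eqP aE] := nbr_ex ap; exists a => i si; apply: nbr_inj.
rewrite nbr_ldir aE; apply: (dir_beyond xadj_sym xadj_connected xadj_bridge _ nsp _ si) => //.
by rewrite eq_sym.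
Qed.

Lemma edge_ends (p q : T) : adj T p q -> exists a b,
  [/\ forall i, (ldir p i == a) = xside (inl p) (inl q) (inr i),
      forall i, (ldir q i == b) = ~~ xside (inl p) (inl q) (inr i) &
      forall i j, splits [set p; q]%SET i j = ((ldir p i == a) != (ldir p j == a))].
Proof.
move=> apq; have apq' : xadj (inl p) (inl q) by [].
have aqp' : xadj (inl q) (inl p) by rewrite xadj_sym.
have [a /eqP aE] := nbr_ex apq'; have [b /eqP bE] := nbr_ex aqp'.
exists a; exists b; split=> i.
- by rewrite ldir_eq aE.
- by rewrite ldir_eq bE (sideC xadj_sym xadj_connected xadj_bridge).
- by move=> j; rewrite !ldir_eq aE splitsE.
Qed.

(** In the language of phylogenetics: the tree displays the quartet [ij|kl]. *)
Definition resolved (i j k l : 'I_n) :=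
  exists2 E, E \in bounded_edges T & [&& ~~ splits E i j, ~~ splits E k l & splits E i k].

(** The two edges would violate [crossing]. *)
Lemma resolved_compat i j k l : resolved i j k l -> resolved i k j l -> False.
Proof.
case=> E /bounded_edgeP[p [q [apq ->]]] E1 [E' /bounded_edgeP[p' [q' [apq' ->]]] E2].
have [b [b' bad]] := crossing xadj_sym xadj_connected xadj_bridge
  (p := inl p) (q := inl q) (p' := inl p') (q' := inl q') apq apq'.
move: E1 E2 (bad (inr i)) (bad (inr j)) (bad (inr k)) (bad (inr l)); rewrite !splitsE //.
by do 4!case: (xside (inl p) _ _); do 4!case: (xside (inl p') _ _); case: b {bad}; case: b'.
Qed.

(** The edge along which [i] and [j] leave [p] separates them from [k] and
    [l]; it is bounded because two different leaves lie beyond it. *)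
Lemma same_direction_resolved (p : T) i j k l : i != j -> ldir p i = ldir p j ->
  ldir p k != ldir p i -> ldir p l != ldir p i -> resolved i j k l.
Proof.
move=> nij Eij nk nl.
have dirE m : xside (inl p) (nbr (ldir p m)) (inr m) by rewrite -ldir_eq.
have [z zE] : exists z : T, nbr (ldir p i) = inl z.
  have := dirE j; rewrite -Eij; move: (dirE i) (nbr_adj (ldir p i)).
  case: (nbr (ldir p i)) => [z|m] si ad sj; first by exists z.
  move: si sj; rewrite !leaf_side // => /eqP[iE] /eqP[jE].
  by rewrite iE jE eqxx in nij.
have apz : adj T p z by have := nbr_adj (ldir p i); rewrite zE.
exists [set p; z]%SET; first by apply/bounded_edgeP; exists p; exists z.
by rewrite !splitsE // -zE -!ldir_eq -Eij !eqxx (negbTE nk) (negbTE nl).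
Qed.

(** The side of an edge away from [p] lies in a single direction at [p], so it
    contains at most one of the four leaves. *)
Lemma distinct_unresolved (p : T) i j k l :
  uniq [:: ldir p i; ldir p j; ldir p k; ldir p l] -> ~ resolved i j k l.
Proof.
rewrite /= !inE !negb_or => /and4P[/and3P[ij _ _] _ kl _] [E EE].
have [f [fE _ fdir]] := edge_direction EE; have [a aP] := fdir p.
rewrite !fE !negbK => /and3P[/eqP eij /eqP ekl neik].
have [ei|ni] := eqVneq (f (leaf T i)) (f p).
  have nk : f (leaf T k) != f p by rewrite -ei eq_sym.
  by rewrite !aP ?eqxx -?ekl // in kl.
by rewrite !aP ?eqxx -?eij // in ij.
Qed.

(** Among the edges that separate [i] from [j], [k] and [l], take one whose
    side with the three leaves is smallest.  Its end on that side is the vertex: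
    if two of the three leaves had a common direction there, the edge in this
    direction would either separate all three from [i], against minimality, or
    resolve the four leaves. *)
Lemma unresolved_vertex i j k l :
  uniq [:: i; j; k; l] ->
  ~ resolved i j k l -> ~ resolved i k j l -> ~ resolved i l j k ->
  exists p, uniq [:: ldir p i; ldir p j; ldir p k; ldir p l].
Proof.
move=> uq nij nik nil.
pose Q (xy : (T + 'I_n) * (T + 'I_n)) := [&& xadj xy.1 xy.2, ~~ xside xy.1 xy.2 (inr i),
   xside xy.1 xy.2 (inr j), xside xy.1 xy.2 (inr k) & xside xy.1 xy.2 (inr l)].
have Q0 : Q (inr i, inl (leaf T i)).
  have a0 : xadj (inr i) (inl (leaf T i)) by rewrite /=.
  have side0 x : xside (inr i) (inl (leaf T i)) x = (x != inr i).
    by rewrite (sideC xadj_sym xadj_connected xadj_bridge) ?leaf_side //=.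
  have inrE a b : (inr a == inr b :> T + 'I_n) = (a == b) by [].
  rewrite /Q /= eqxx !side0 !inrE eqxx /=.
  by move: uq; rewrite /= !inE !negb_or !(eq_sym i) => /andP[/and3P[-> -> ->] _].
case: (arg_minnP (fun xy => #|xside xy.1 xy.2|) Q0) => -[x y] /and5P[/= axy si sj sk sl] min.
have {min} min z : xadj y z -> z != x -> xside y z (inr j) -> xside y z (inr k) -> xside y z (inr l) -> False.
  move=> ayz nzx zj zk zl.
  have := side_card_lt axy ayz nzx; rewrite ltnNge => /negP; apply.
  apply: (min (y, z)); rewrite /Q /= ayz zj zk zl !andbT /=.
  by apply: contra si; apply: beyond_sub.
case: y axy si sj sk sl min => [y|m] axy si sj sk sl min; last first.
  move: uq; rewrite /= !inE !negb_or => /and3P[_ /andP[jk _] _].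
  by move: sj sk; rewrite !leaf_side // => /eqP[jE] /eqP[kE]; rewrite jE kE eqxx in jk.
exists y.
have ayx : xadj (inl y) x by rewrite xadj_sym.
have dirE m : xside (inl y) (nbr (ldir y m)) (inr m) by rewrite -ldir_eq.
have di : nbr (ldir y i) = x.
  rewrite nbr_ldir; apply: (dir_side xadj_sym xadj_connected xadj_bridge ayx).
  by rewrite (sideC xadj_sym xadj_connected xadj_bridge).
have dn m : xside x (inl y) (inr m) -> nbr (ldir y m) != x.
  move=> sm; apply: contraTneq (dirE m) => ->.
  by rewrite (sideC xadj_sym xadj_connected xadj_bridge) // sm.
have ni m : xside x (inl y) (inr m) -> ldir y i != ldir y m.
  by move=> sm; apply: contraNneq (dn m sm) => <-; rewrite di.
have same a b : ldir y a = ldir y b -> xside (inl y) (nbr (ldir y a)) (inr b) by move=> ->.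
move: uq; rewrite /= !inE !negb_or => /and4P[/and3P[ij ik il] /andP[jk jl] kl _].
rewrite !ni //=.
have two a b c : xside x (inl y) (inr a) -> a != b -> ldir y a = ldir y b ->
    ldir y c != ldir y a -> resolved i c a b.
  move=> sa ab E nc; have [E' EE' H] := same_direction_resolved ab E nc (ni a sa).
  exists E' => //; have [phi phiE] := splits_fun EE'.
  by move: H; rewrite !phiE; do 4!case: (phi _).
have all3 : ~ (ldir y j = ldir y k /\ ldir y j = ldir y l).
  case=> Ejk Ejl; by apply: (min (nbr (ldir y j))); rewrite ?dn //; [exact: nbr_adj|exact: same|exact: same].
apply/and3P; split => //; first (apply/andP; split); apply/eqP => E.
- have [E2|E2] := eqVneq (ldir y l) (ldir y j); first by apply: all3; rewrite -E E2.
  exact: nil (two j k l sj jk E E2).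
- have [E2|E2] := eqVneq (ldir y k) (ldir y j); first by apply: all3; rewrite -E E2.
  exact: nik (two j l k sj jl E E2).
- have [E2|E2] := eqVneq (ldir y j) (ldir y k); first by apply: all3; rewrite E2 E.
  exact: nij (two k l j sk kl E E2).
Qed.

End MarkedTree.

(** * Pair vectors and the four-point condition *)

Local Open Scope ring_scope.

Section QuotientMap.
Variables (R : fieldType) (V : vectType R) (U : {vspace V}).

Lemma quotv_piK (w : quotv U) : quotv_pi U (vsval w) = w.
Proof.
suff E : vsval (quotv_pi U (vsval w)) = vsval w by apply: val_inj.
by rewrite quotv_piE daddv_pi_id ?subvsP // capvC capv_compl.
Qed.

Lemma quotv_pi_eq (u v : V) : (quotv_pi U u == quotv_pi U v) = (u - v \in U).
Proof. by have := memv_ker (quotv_pi U) (u - v); rewrite quotv_ker linearB subr_eq0 => ->. Qed.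

Lemma quotv_pi0 (v : V) : (quotv_pi U v == 0) = (v \in U).
Proof. by have := memv_ker (quotv_pi U) v; rewrite quotv_ker => ->. Qed.

Lemma vsval_quotv_pi (v : V) : vsval (quotv_pi U v) - v \in U.
Proof. by rewrite -quotv_pi_eq quotv_piK. Qed.

End QuotientMap.

Section PairVectors.
Variables (R : realType) (n : nat).
Implicit Types (v w : pair_space R n) (i j k l : 'I_n).

(** The entry at an unordered pair, 0 on the diagonal, so that formulas do not
    have to sort their indices. *)
Definition at_pair i j v : R :=
  oapp (fun ij : index_pair n => v ij : R) 0 (insub (if (i < j)%N then (i, j) else (j, i))).

Lemma at_pair_linear i j : scalar (at_pair i j).
Proof.
move=> a v w; rewrite /at_pair; case: insubP => [ij _ _|_] /=.
  by rewrite !ffunE.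
by rewrite mulr0 addr0.
Qed.

HB.instance Definition _ i j :=
  GRing.isLinear.Build R (pair_space R n) R *%R (at_pair i j) (at_pair_linear i j).

Lemma at_pairC i j v : at_pair i j v = at_pair j i v.
Proof.
rewrite /at_pair; case: (ltngtP i j) => // /val_inj ->; by [].
Qed.

Lemma at_pairxx i v : at_pair i i v = 0.
Proof. by rewrite /at_pair ltnn insubF //= ltnn. Qed.

Lemma at_pairE v (ij : index_pair n) : v ij = at_pair (sval ij).1 (sval ij).2 v.
Proof.
by rewrite /at_pair (valP ij) -surjective_pairing valK.
Qed.

Lemma at_pair_ext v w : (forall i j, i != j -> at_pair i j v = at_pair i j w) -> v = w.
Proof.
move=> E; apply/ffunP => ij; rewrite !at_pairE E //.
by apply: contraTneq (valP ij) => ->; rewrite ltnn.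
Qed.

Definition pair_vec (g : 'I_n -> 'I_n -> R) : pair_space R n :=
  [ffun ij : index_pair n => g (sval ij).1 (sval ij).2 : R^o].

Lemma at_pair_vec g i j : (forall i j, g i j = g j i) -> i != j ->
  at_pair i j (pair_vec g) = g i j.
Proof.
move=> gC nij; rewrite /at_pair; case: ltngtP => [lt|lt|/val_inj E].
- by rewrite insubT /= ffunE.
- by rewrite insubT /= ffunE gC.
- by rewrite E eqxx in nij.
Qed.

Lemma at_pair_Phi i j (a : 'rV[R]_n) : i != j -> at_pair i j (Phi_fun a) = a 0 i + a 0 j.
Proof. by move=> nij; rewrite (@at_pair_vec (fun i j => a 0 i + a 0 j)) // => *; apply: addrC. Qed.

(** Quantified over all orders of the four leaves, this says that the maximum
    of the three sums is attained at least twice. *)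
Definition four_point v := forall i j k l, uniq [:: i; j; k; l] ->
  at_pair i j v + at_pair k l v
    <= Num.max (at_pair i k v + at_pair j l v) (at_pair i l v + at_pair j k v).

Notation pi := (quotv_pi (limg (Phi R n))).

Lemma Phi_imgP v : reflect (exists a : 'rV[R]_n, v = Phi_fun a) (v \in limg (Phi R n)).
Proof.
apply: (iffP memv_imgP) => [[a _ ->]|[a ->]]; exists a; rewrite ?lfunE //=.
exact: memvf.
Qed.

Lemma pi_eqP v w : reflect (exists a : 'rV[R]_n, v = w + Phi_fun a) (pi v == pi w).
Proof.
rewrite quotv_pi_eq; apply: (iffP (Phi_imgP _)) => -[a E]; exists a.
  by rewrite -E addrC subrK.
by rewrite E addrC addKr.
Qed.

Lemma four_point_Phi v a : four_point v -> four_point (v + Phi_fun a).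
Proof.
move=> fp i j k l uq; have := fp _ _ _ _ uq; rewrite !linearD /=.
move: uq; rewrite /= !inE !negb_or => /and4P[/and3P[ij ik il] /andP[jk jl] kl _].
rewrite !at_pair_Phi // !le_max => /orP[]le; apply/orP; [left|right]; lra.
Qed.

Lemma four_point_pi v w : pi v = pi w -> four_point v -> four_point w.
Proof. by move=> /esym/eqP/pi_eqP[a ->]; apply: four_point_Phi. Qed.

End PairVectors.

Section TreeMetric.
Variables (R : realType) (n : nat) (T : combinatorial_type n) (len : {set T} -> R).

Lemma path_distance (u : T) s : path (adj T) u s -> uniq (u :: s) ->
  \sum_(r <- pairmap (fun a b => len [set a; b]%SET) u s) r
    = \sum_(E in bounded_edges T) len E *+ separated (adj T) E u (last u s).
Proof.
exact: (path_length (@adj_sym _ T) (@adj_connected _ T) (@adj_bridge _ T)).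
Qed.

Lemma distanceE (u v : T) :
  distance len u v = \sum_(E in bounded_edges T) len E *+ separated (adj T) E u v.
Proof.
have /and3P[ps /eqP lv us] := xchooseP (simple_path_exists u v).
by rewrite /distance path_distance // lv.
Qed.

Lemma at_distance_vector (i j : 'I_n) :
  at_pair i j (distance_vector len)
    = \sum_(E in bounded_edges T) len E *+ splits E i j :> R.
Proof.
have [->|nij] := eqVneq i j.
  rewrite big1 => [|E _]; last by rewrite /splits /separated connect0.
  by rewrite at_pairxx.
apply: etrans (distanceE (leaf T i) (leaf T j)).
apply: (at_pair_vec (g := fun i j => distance len (leaf T i) (leaf T j))) nij => x y.
 rewrite !distanceE; apply: eq_bigr => E _; rewrite sep_sym //.
exact: (@adj_sym _ T).
Qed.

Hypothesis len_ge0 : forall E, E \in bounded_edges T -> 0 <= len E.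

(** A single edge can increase the left-hand sum above the right-hand one only
    by separating [i, k] from [j, l]. *)
Lemma splits_le (i j k l : 'I_n) E : ~ resolved T i k j l -> E \in bounded_edges T ->
  (splits E i j + splits E k l <= splits E i k + splits E j l)%N.
Proof.
move=> nr EE; have [phi phiE] := splits_fun EE.
have : ~~ [&& ~~ splits E i k, ~~ splits E j l & splits E i j].
  by apply/negP => H; apply: nr; exists E.
by rewrite !phiE; do 4!case: (phi _).
Qed.

Lemma distance_le (i j k l : 'I_n) : ~ resolved T i k j l ->
  at_pair i j (distance_vector len) + at_pair k l (distance_vector len)
   <= at_pair i k (distance_vector len) + at_pair j l (distance_vector len).
Proof.
move=> nr; rewrite !at_distance_vector -!big_split /=; apply: ler_sum => E EE.
by rewrite -!mulrnDr; apply: ler_wpMn2l; [exact: len_ge0 | exact: splits_le].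
Qed.

(** At most one of the three quartets is displayed, so one of the two
    comparisons of [distance_le] applies. *)
Lemma distance_four_point : four_point (distance_vector len).
Proof.
move=> i j k l _; rewrite le_max.
have [r|nr] := pselect (resolved T i k j l).
  have nr' : ~ resolved T i l j k.
    by case: r => E EE; have [phi phiE] := splits_fun EE; rewrite !phiE => H;
       case=> E' EE'; have [psi psiE] := splits_fun EE'; rewrite !psiE => H';
       apply: (@resolved_compat _ T i k l j); [exists E | exists E'] => //;
       rewrite ?phiE ?psiE; move: H H'; do 4!case: (phi _); do 4!case: (psi _).
  apply/orP; right; have := @distance_le i j l k nr'.
  by rewrite (at_pairC l k).
by apply/orP; left; apply: distance_le.
Qed.

End TreeMetric.

Lemma distance_lt (R : realType) n (C : curve R n) (i j k l : 'I_n) : resolved C i j k l ->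
  at_pair i j (distance_vector (@len R n C)) + at_pair k l (distance_vector (@len R n C))
   < at_pair i k (distance_vector (@len R n C)) + at_pair j l (distance_vector (@len R n C)).
Proof.
move=> r; rewrite !at_distance_vector -!big_split /=.
have nr : ~ resolved C i k j l by apply: resolved_compat r.
case: r => E EE H.
rewrite (bigD1 E) //= [in ltRHS](bigD1 E) //=; apply: ltr_leD.
  have [phi phiE] := splits_fun EE; have := len_gt0 EE.
  move: H; rewrite !phiE; (do 4!case: (phi _)) => //= _; rewrite ?mulr0n ?mulr1n; lra.
apply: ler_sum => E' /andP[EE' _].
by rewrite -!mulrnDr; apply: ler_wpMn2l; [exact/ltW/len_gt0 | exact: splits_le].
Qed.

Lemma support_four_point (R : realType) n (v : pair_space R n) :
  moduli_support (quotv_pi (limg (Phi R n)) v) -> four_point v.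
Proof.
case=> C E; apply: (four_point_pi (esym E)).
by apply: distance_four_point => e /len_gt0/ltW.
Qed.

(** * Four-point vectors are tree metrics *)

Lemma at_pair_distance (R : realType) n (T : combinatorial_type n) (len : {set T} -> R) i j :
  at_pair i j (distance_vector len) = distance len (leaf T i) (leaf T j) :> R.
Proof. exact: etrans (at_distance_vector len i j) (esym (distanceE len _ _)). Qed.

(** No edge except the first one distinguishes [u] from [u']. *)
Lemma distance_step (R : realType) n (T : combinatorial_type n) (len : {set T} -> R) u u' w :
  adj T u u' -> side (adj T) u u' w ->
  distance len u w = len [set u; u']%SET + distance len u' w.
Proof.
move=> auu sw; rewrite !distanceE.
have EE : [set u; u']%SET \in bounded_edges T by apply/bounded_edgeP; exists u; exists u'.
rewrite (bigD1 _ EE) //= [in RHS](bigD1 _ EE) //=.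
have -> : separated (adj T) [set u; u']%SET u' w = false by apply/negbTE; rewrite negbK.
have -> : separated (adj T) [set u; u']%SET u w = true.
  rewrite (sep_side (@adj_sym _ T) (@adj_connected _ T) (@adj_bridge _ T)) // sw sidex //.
    exact: (@adj_sym _ T).
  exact: (@adj_bridge _ T).
rewrite mulr0n add0r mulr1n; congr (_ + _); apply: eq_bigr => E /andP[_ nE]; congr (_ *+ ~~ _).
apply: (same_connect (without_connect_sym (@adj_sym _ T) E)); apply: connect1.
by rewrite /without /= auu eq_sym.
Qed.

Lemma graph_valence_ge3 n (V : finType) (adj : rel V) (leaf : 'I_n -> V) (p : V)
    (ok := fun x : V + 'I_n => match x with inl q => adj p q | inr i => leaf i == p end) x y z :
  ok x -> ok y -> ok z -> uniq [:: x; y; z] -> (3 <= graph_valence adj leaf p)%N.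
Proof.
move=> okx oky okz uq.
rewrite graph_valenceE.
rewrite -[3%N]/(size [:: x; y; z]) -(card_uniqP uq); apply: subset_leq_card.
by apply/fintype.subsetP => u; rewrite !inE => /or3P[]/eqP ->.
Qed.

Section Buneman.
Variables (R : realType) (n : nat) (v : pair_space R n) (rho : 'I_n).
Hypothesis fpv : four_point v.
Hypothesis n_ge3 : (3 <= n)%N.

(** Subtracting an element of the image of [Phi], all entries at [rho] become 0.
    The four-point condition for [i, j, k, rho] is then the ultrametric
    inequality for [i, j, k] ([near_trans]), and the tree is the tree of balls
    of this ultrametric, with [rho] attached at the top. *)
Definition height i j : R := at_pair i j v - at_pair i rho v - at_pair j rho v.

Lemma heightC i j : height i j = height j i.
Proof. by rewrite /height (at_pairC i j) addrAC. Qed.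

(** The distance of a leaf to itself is regarded as minus infinity: the values
    of [height] may be negative. *)
Definition near (h : R) i j := (i == j) || (height i j <= h).

Lemma near_sym h i j : near h i j = near h j i.
Proof. by rewrite /near eq_sym heightC. Qed.

Lemma near_trans h i j k : i != rho -> j != rho -> k != rho ->
  near h i j -> near h j k -> near h i k.
Proof.
move=> ir jr kr; rewrite /near.
have [->|ij] /= := eqVneq i j; first by [].
have [->|jk] /= := eqVneq j k; first by rewrite orbC => ->.
have [//|ik] /= := eqVneq i k.
have uq : uniq [:: i; k; j; rho].
  by rewrite /= !inE !negb_or ik ij ir kr jr eq_sym jk.
move=> h1 h2; have := fpv uq; rewrite (at_pairC k j).
by move: h1 h2; rewrite /height le_max => h1 h2 /orP[] h3; lra.
Qed.

Definition ball i (h : R) : {set 'I_n} := [set m | (m != rho) && near h i m]%SET.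

Definition proper_pair (x : 'I_n * 'I_n) := [&& x.1 != x.2, x.1 != rho & x.2 != rho].

Definition clusters : {set {set 'I_n}} :=
  [set ball x.1 (height x.1 x.2) | x in proper_pair]%SET.

(** Computed from an arbitrary presentation of [B] as a ball; by
    [cluster_radius] and [height_le_radius] it is the diameter of [B], whatever
    the presentation. *)
Definition radius (B : {set 'I_n}) : R :=
  oapp (fun x => height x.1 x.2) 0
    [pick x | proper_pair x && (B == ball x.1 (height x.1 x.2))].

Lemma radius_pair B : B \in clusters -> exists i j,
  [/\ proper_pair (i, j), B = ball i (height i j) & radius B = height i j].
Proof.
case/imsetP => x px BE; rewrite /radius; case: pickP => [[i j] /andP[pij /eqP E]|no] /=.
  by exists i; exists j.
by have := no x; rewrite BE eqxx andbT => npx; rewrite [_ \in _]npx in px.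
Qed.

Lemma cluster_radius B : B \in clusters -> exists i j,
  [/\ i \in B, j \in B, i != j & radius B = height i j].
Proof.
case/radius_pair => i [j [/and3P[/= ij ir jr] -> ->]]; exists i; exists j.
by rewrite !inE ir jr /near eqxx lexx orbT ij.
Qed.

Lemma cluster_rho B i : B \in clusters -> i \in B -> i != rho.
Proof. by case/radius_pair => k [l [_ -> _]]; rewrite inE => /andP[]. Qed.

(** Every point of a ball in an ultrametric space is a centre. *)
Lemma cluster_ball B k : B \in clusters -> k \in B -> B = ball k (radius B).
Proof.
case/radius_pair => i [j [/and3P[/= ij ir jr] -> ->]]; rewrite inE => /andP[kr ik].
apply/setP => m; rewrite !inE; apply: andb_id2l => mr.
by apply/idP/idP; apply: near_trans; rewrite // near_sym.
Qed.

Lemma height_le_radius B k l : B \in clusters -> k \in B -> l \in B -> k != l ->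
  height k l <= radius B.
Proof.
move=> cB kB; rewrite {1}(cluster_ball cB kB) inE => /andP[_]; rewrite /near.
by case: eqP.
Qed.

Lemma ball_sub k h h' : h <= h' -> ball k h \subset ball k h'.
Proof.
move=> hh; apply/fintype.subsetP => m; rewrite !inE => /andP[-> /orP[/eqP ->|le]].
  by rewrite /near eqxx.
by rewrite /near (le_trans le hh) orbT.
Qed.

Lemma radius_lt B B' : B \in clusters -> B' \in clusters -> B \proper B' -> radius B < radius B'.
Proof.
move=> cB cB' pBB; have [k [_ [kB _ _ _]]] := cluster_radius cB.
have kB' : k \in B' by apply: (fintype.subsetP (proper_sub pBB)).
rewrite ltNge; apply/negP => le.
have : B' \subset B by rewrite (cluster_ball cB kB) (cluster_ball cB' kB') ball_sub.
by move: pBB; rewrite properE => /andP[_ /negP].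
Qed.

(** Two balls with a common centre are compared by their radii. *)
Lemma laminar B B' k : B \in clusters -> B' \in clusters -> k \in B -> k \in B' ->
  (B \subset B') || (B' \proper B).
Proof.
move=> cB cB' kB kB'; rewrite (cluster_ball cB kB) (cluster_ball cB' kB').
have [le|lt] := leP (radius B) (radius B'); first by rewrite ball_sub.
rewrite orbC properE ball_sub ?ltW //=; by case: (_ \subset _).
Qed.

Lemma laminar_sub B B' C : B \in clusters -> B' \in clusters -> C \in clusters ->
  C \subset B -> C \subset B' -> (B \subset B') || (B' \proper B).
Proof.
move=> cB cB' cC sB sB'; have [k [_ [kC _ _ _]]] := cluster_radius cC.
by apply: (@laminar _ _ k) => //; [move: sB|move: sB'] => /fintype.subsetP; apply.
Qed.

Lemma join_cluster i j : i != j -> i != rho -> j != rho ->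
  [/\ ball i (height i j) \in clusters, i \in ball i (height i j), j \in ball i (height i j),
      radius (ball i (height i j)) = height i j &
      forall B, B \in clusters -> i \in B -> j \in B -> ball i (height i j) \subset B].
Proof.
move=> ij ir jr; set B0 := ball i _.
have c0 : B0 \in clusters by apply/imsetP; exists (i, j) => //; apply/and3P.
have iB : i \in B0 by rewrite inE ir /near eqxx.
have jB : j \in B0 by rewrite inE jr /near lexx orbT.
split => //; last first.
  by move=> B cB iB' jB'; rewrite (cluster_ball cB iB') ball_sub // height_le_radius.
apply/eqP; rewrite eq_le height_le_radius // andbT.
have [k [l [kB lB kl ->]]] := cluster_radius c0.
have kr := cluster_rho c0 kB; have lr := cluster_rho c0 lB.
have : near (height i j) k l.
  move: kB lB; rewrite !inE => /andP[_ ki] /andP[_ li].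
  by apply: near_trans li => //; rewrite near_sym.
by rewrite /near (negbTE kl).
Qed.

Definition whole : {set 'I_n} := [set~ rho]%SET.

Lemma whole_cluster : whole \in clusters.
Proof.
have : (1 < #|whole|)%N by rewrite cardsC1 card_ord; lia.
case/card_gt1P => i [j [iW jW ij]].
have p0 : proper_pair (i, j) by move: iW jW; rewrite !inE /proper_pair /= ij => -> ->.
case: (@arg_maxP _ _ _ (i, j) proper_pair (fun x => height x.1 x.2) p0) => x px max.
apply/imsetP; exists x => //; apply/setP => m; rewrite !inE.
have [//|mr] /= := eqVneq m rho.
rewrite /near; have [//|xm] /= := eqVneq x.1 m.
by apply/esym; apply: (max (x.1, m)); rewrite /proper_pair /= xm mr; case/and3P: px => _ ->.
Qed.

Lemma cluster_whole B : B \in clusters -> B \subset whole.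
Proof.
by move=> cB; apply/fintype.subsetP => i /(cluster_rho cB); rewrite !inE.
Qed.

(** [B'] is the parent of [B] in the tree of balls. *)
Definition covers (B B' : {set 'I_n}) :=
  (B \proper B') && [forall C in clusters, ~~ ((B \proper C) && (C \proper B'))].

Lemma coversP B B' C : covers B B' -> C \in clusters -> B \proper C -> C \proper B' -> False.
Proof. by move=> /andP[_ /forall_inP H] /H; move=> /negP H' H1 H2; apply: H'; rewrite H1. Qed.

Lemma covers_proper B B' : covers B B' -> B \proper B'. Proof. by case/andP. Qed.

Lemma covers_unique B B1 B2 : B \in clusters -> B1 \in clusters -> B2 \in clusters ->
  covers B B1 -> covers B B2 -> B1 = B2.
Proof.
move=> cB c1 c2 v1 v2; have p1 := covers_proper v1; have p2 := covers_proper v2.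
have := laminar_sub c1 c2 cB (proper_sub p1) (proper_sub p2).
case/orP => [|p]; last by case: (coversP v1 c2 p2 p).
by rewrite subEproper => /orP[/eqP //|p]; case: (coversP v2 c1 p1 p).
Qed.

Lemma parent_ex B : B \in clusters -> B != whole -> exists2 P, P \in clusters & covers B P.
Proof.
move=> cB nB; pose Q P := (P \in clusters) && (B \proper P).
have Q0 : Q whole by rewrite /Q whole_cluster finset.properEneq nB cluster_whole.
case: (arg_minnP (fun P : {set 'I_n} => #|P|) Q0) => P /andP[cP pP] min; exists P => //.
rewrite /covers pP; apply/forall_inP => C cC; apply/negP => /andP[p1 p2].
have := min C; rewrite /Q cC p1 => /(_ isT); rewrite leqNgt.
by rewrite proper_card.
Qed.

Lemma child_ex B i C : B \in clusters -> C \in clusters -> i \in C -> C \proper B ->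
  exists C', [/\ C' \in clusters, i \in C' & covers C' B].
Proof.
move=> cB cC iC pC; pose Q P := [&& P \in clusters, i \in P & P \proper B].
have Q0 : Q C by rewrite /Q cC iC.
case: (arg_maxnP (fun P : {set 'I_n} => #|P|) Q0) => P /and3P[cP iP pP] max; exists P; split => //.
rewrite /covers pP; apply/forall_inP => D cD; apply/negP => /andP[p1 p2].
have := max D; rewrite /Q cD p2 (fintype.subsetP (proper_sub p1)) // => /(_ isT).
by move=> le; move: (proper_card p1); rewrite ltnNge; case/negP.
Qed.

Definition node : Type := {B : {set 'I_n} | B \in clusters}.
HB.instance Definition _ := Finite.on node.
Implicit Types (x y z : node).

Definition top_node : node := exist _ whole whole_cluster.

Definition node_adj : rel node := fun x y => covers (val x) (val y) || covers (val y) (val x).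

(** A leaf is attached to the smallest ball that satisfies this condition. *)
Definition at_node i x := if i == rho then val x == whole else i \in val x.

Lemma node_leaf_subproof i : exists x, at_node i x && [forall y, at_node i y ==> (val x \subset val y)].
Proof.
rewrite /at_node; have [_|ir] := eqVneq i rho.
  exists top_node; rewrite eqxx /=.
  by apply/forallP => y; apply/implyP => /eqP ->.
have Q0 : i \in val top_node by rewrite !inE.
case: (@arg_minnP _ top_node (fun x => i \in val x) (fun x => #|val x|) Q0) => x ix min; exists x; rewrite ix /=.
apply/forallP => y; apply/implyP => iy.
case/orP: (laminar (valP x) (valP y) ix iy) => // p.
by have := min y iy; rewrite leqNgt proper_card.
Qed.

Definition node_leaf i : node := xchoose (node_leaf_subproof i).

Lemma node_leaf_at i : at_node i (node_leaf i).
Proof. by case/andP: (xchooseP (node_leaf_subproof i)). Qed.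

Lemma node_leaf_sub i y : at_node i y -> val (node_leaf i) \subset val y.
Proof. by case/andP: (xchooseP (node_leaf_subproof i)) => _ /forallP/(_ y)/implyP. Qed.

Lemma node_leaf_in i : i != rho -> i \in val (node_leaf i).
Proof. by have := node_leaf_at i; rewrite /at_node => + /negbTE E; rewrite E. Qed.

Lemma node_adj_sym : symmetric node_adj.
Proof. by move=> x y; rewrite /node_adj orbC. Qed.

Lemma node_adj_irr : irreflexive node_adj.
Proof. by move=> x; rewrite /node_adj /covers fintype.properxx. Qed.

Lemma node_gt0 : (0 < #|{: node}|)%N.
Proof. by apply/card_gt0P; exists top_node. Qed.

Lemma node_parent x : x != top_node -> exists y, covers (val x) (val y).
Proof.
move=> nx; have [|P cP covers] := parent_ex (valP x); first exact: nx.
by exists (exist _ P cP).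
Qed.

Lemma node_adj_connected x y : connect node_adj x y.
Proof.
have csym : connect_sym node_adj by apply/sym_connect_sym/node_adj_sym.
suff top z : connect node_adj z top_node by rewrite (connect_trans (top x)) // csym.
move: {2}_.+1 (ltnSn (n - #|val z|)) => m; elim: m z => // m IH z le.
have [->|nz] := eqVneq z top_node; first exact: connect0.
have [P cP] := node_parent nz.
apply: (connect_trans (connect1 _)) (IH P _); first by rewrite /node_adj cP.
have := proper_card (covers_proper cP); have := max_card (val P); rewrite card_ord.
move: le; lia.
Qed.

(** A smallest cluster on a cycle has two larger neighbours; both are its
    parent, so they coincide. *)
Lemma node_adj_acyclic (c : seq node) : ucycle node_adj c -> (size c <= 2)%N.
Proof.
case: c => // x0 c0; set c := x0 :: c0 => uc.
have Q0 : x0 \in c by rewrite mem_head.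
case: (@arg_minnP _ x0 (fun x => x \in c) (fun x : node => #|val x|) Q0) => x xc min.
have [i s E] := rot_to xc.
have us : ucycle node_adj (x :: s) by rewrite -E rot_ucycle.
have -> : size c = size (x :: s) by rewrite -E size_rot.
have {min} min y : y \in s -> (#|val x| <= #|val y|)%N.
  by move=> ys; apply: min; rewrite -(mem_rot i) E inE ys orbT.
have up y : y \in s -> node_adj x y -> covers (val x) (val y).
  move=> /min le /orP[//|/covers_proper/proper_card]; by rewrite ltnNge le.
case: s us {E} min up => [|y s] //; case/lastP: s => // s z.
rewrite /ucycle /= rcons_path last_rcons => /andP[/and3P[axy _ azx]] /and3P[_ ny _] min up.
have yE : y = z.
  apply: val_inj; apply: (@covers_unique (val x)); try exact: valP.
    by apply: up axy; rewrite mem_head.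
  by apply: up; [rewrite inE mem_rcons mem_head orbT | rewrite node_adj_sym].
by rewrite yE mem_rcons mem_head in ny.
Qed.

(** Two leaves of a cluster whose distance is its diameter lie in different
    children or are attached to the cluster itself; the third direction is the
    parent, or [rho] at the top. *)
Lemma nvalence_ge3 x : (3 <= graph_valence node_adj node_leaf x)%N.
Proof.
set B := val x; have cB : B \in clusters := valP x.
have [i [j [iB jB ij hB]]] := cluster_radius cB.
have item k : k \in B -> exists y : node + 'I_n,
    match y with inl C => k \in val C /\ covers (val C) B | inr m => m = k /\ node_leaf m = x end.
  move=> kB; have kr := cluster_rho cB kB.
  have sub : val (node_leaf k) \subset B by apply: node_leaf_sub; rewrite /at_node (negbTE kr).
  move: sub; rewrite subEproper => /orP[/eqP E|p].
    by exists (inr k); split=> //; apply: val_inj.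
  have [C [cC kC covC]] := child_ex cB (valP (node_leaf k)) (node_leaf_in kr) p.
  by exists (inl (exist _ C cC)).
have [y1 ok1] := item i iB; have [y2 ok2] := item j jB.
have ok k (y : node + 'I_n) :
    match y with inl C => k \in val C /\ covers (val C) B | inr m => m = k /\ node_leaf m = x end ->
    match y with inl q => node_adj x q | inr i => node_leaf i == x end.
  by case: y => [C [_ cC]|m [_ ->]] //; rewrite /node_adj cC orbT.
have n12 : y1 != y2.
  apply/eqP => E; rewrite -{}E in ok2; case: y1 ok1 ok2 => [C [iC cC] [jC _]|m [-> _] [E _]].
    have := radius_lt (valP C) cB (covers_proper cC); rewrite hB ltNge => /negP; apply.
    exact: height_le_radius (valP C) iC jC ij.
  by rewrite E eqxx in ij.
have [xt|nx] := eqVneq x top_node.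
  apply: (@graph_valence_ge3 _ _ _ _ _ y1 y2 (inr rho)); [exact: ok ok1|exact: ok ok2| |].
    apply/eqP; apply: val_inj; have := node_leaf_at rho; rewrite /at_node eqxx => /eqP ->.
    by rewrite xt.
  rewrite /= !inE !negb_or n12 /= andbT; apply/andP; split; apply/eqP => E; rewrite {}E in ok1 ok2 n12.
    by case: ok1 => E _; have := cluster_rho cB iB; rewrite -E eqxx.
  by case: ok2 => E _; have := cluster_rho cB jB; rewrite -E eqxx.
have [P cP] := node_parent nx.
apply: (@graph_valence_ge3 _ _ _ _ _ y1 y2 (inl P)); [exact: ok ok1|exact: ok ok2| |].
  by rewrite /node_adj cP.
have no k : ~ (k \in val P /\ covers (val P) B).
  move=> [_ /covers_proper p]; have := proper_trans p (covers_proper cP); by rewrite fintype.properxx.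
rewrite /= !inE !negb_or n12 /= andbT; apply/andP; split; apply/eqP => E; rewrite {}E in ok1 ok2 n12.
  exact: no ok1.
exact: no ok2.
Qed.

Definition cluster_tree : combinatorial_type n :=
  CombinatorialType node_adj_sym node_adj_irr node_gt0 node_adj_connected node_adj_acyclic nvalence_ge3.

(** Half the difference of the radii of the ends: an unordered pair of ends
    occurs twice in the double sum, which accounts for the denominator 4. *)
Definition cluster_len (E : {set cluster_tree}) : R :=
  (\sum_(x in E) \sum_(y in E) `|radius (val x) - radius (val y)|) / 4.

Lemma cluster_len_cov (x y : cluster_tree) : covers (val x) (val y) ->
  cluster_len [set x; y]%SET = (radius (val y) - radius (val x)) / 2.
Proof.
move=> c; have lt := radius_lt (valP x) (valP y) (covers_proper c).
have nxy : x != y by apply: contraTneq c => ->; rewrite /covers fintype.properxx.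
rewrite /cluster_len !big_setU1 ?inE //= !big_set1 !big_setU1 ?inE //= !big_set1 !subrr normr0.
by rewrite (distrC (radius (val x))) gtr0_norm ?subr_gt0 //; field.
Qed.

Lemma cluster_len_gt0 E : E \in bounded_edges cluster_tree -> 0 < cluster_len E.
Proof.
case/bounded_edgeP => x [y [/orP[c|c] ->]].
  by rewrite cluster_len_cov // divr_gt0 // subr_gt0 radius_lt ?covers_proper //; exact: valP.
by rewrite finset.setUC cluster_len_cov // divr_gt0 // subr_gt0 radius_lt ?covers_proper //; exact: valP.
Qed.

Definition cluster_curve : curve R n := Curve cluster_len_gt0.

(** Being contained in [x] changes only across the edge from [x] to its
    parent. *)
Lemma side_above (x y w : cluster_tree) : covers (val x) (val y) -> ~~ (val w \subset val x) ->
  side (adj cluster_tree) x y w.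
Proof.
move=> c nw; have pxy := covers_proper c.
rewrite (side_char (@adj_sym _ cluster_tree) (@adj_connected _ cluster_tree) (@adj_bridge _ cluster_tree)
  (phi := fun z : cluster_tree => ~~ (val z \subset val x))) //.
- by rewrite /= /node_adj c.
- suff gen (z z' : node) : covers (val z) (val z') -> [set z; z']%SET != [set x; y]%SET ->
      (val z \subset val x) = (val z' \subset val x).
    move=> z z' /orP[] c' nE; first by rewrite (gen z z').
    by rewrite (gen z' z) // finset.setUC.
  move=> c' nE; have p' := covers_proper c'; apply/idP/idP => s; last first.
    exact: fintype.subset_trans (proper_sub p') s.
  move: (s); rewrite subEproper => /orP[/eqP/val_inj E|p].
    case/eqP: nE; rewrite E; congr [set _; _]%SET; apply: val_inj.
    by apply: (@covers_unique (val x)); rewrite -?E //; try exact: valP; rewrite E.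
  case/orP: (laminar_sub (valP z') (valP x) (valP z) (proper_sub p') s) => // pp.
  by case: (coversP c' (valP x) p pp).
- by move: pxy; rewrite properE => /andP[].
- by rewrite negbK.
Qed.

(** From a node that does not contain [w] the way to [w] leads through the
    parent, so the length of the way up to [y] telescopes. *)
Lemma distance_up (x y w : cluster_tree) : val x \subset val y ->
  (forall z : node, val x \subset val z -> val z \proper val y -> ~~ (val w \subset val z)) ->
  distance cluster_len x w = (radius (val y) - radius (val x)) / 2 + distance cluster_len y w.
Proof.
move: {2}_.+1 (ltnSn (#|val y| - #|val x|)) => m; elim: m x => // m IH x le sxy H.
move: (sxy); rewrite subEproper => /orP[/eqP/val_inj ->|p]; first by rewrite subrr mul0r add0r.
have nx : x != top_node.
  apply: contraTneq p => ->; rewrite properE cluster_whole ?andbF //; exact: valP.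
have [P cP] := node_parent nx; have pP := covers_proper cP.
have sPy : val P \subset val y.
  case/orP: (laminar_sub (valP P) (valP y) (valP x) (proper_sub pP) sxy) => // pp.
  by case: (coversP cP (valP y) p pp).
rewrite (@distance_step _ _ _ _ x P) //; first last.
- by apply: side_above => //; apply: H.
- by rewrite /= /node_adj cP.
rewrite cluster_len_cov // (IH P) //; first by field.
- have c1 := proper_card pP; have c2 := leq_trans c1 (subset_leq_card sPy).
  by rewrite ltnS in le; apply: leq_trans le; apply: ltn_sub2l.
- by move=> z sz; apply: H; apply: fintype.subset_trans (proper_sub pP) sz.
Qed.

Lemma distance_sym (x y : cluster_tree) : distance cluster_len x y = distance cluster_len y x.
Proof.
rewrite !distanceE; apply: eq_bigr => E _; rewrite sep_sym //; exact: (@adj_sym _ cluster_tree).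
Qed.

Lemma distance_refl (x : cluster_tree) : distance cluster_len x x = 0.
Proof. by rewrite distanceE big1 // => E _; rewrite /separated connect0. Qed.

Lemma distance_above (x y : cluster_tree) : val x \subset val y ->
  distance cluster_len x y = (radius (val y) - radius (val x)) / 2.
Proof.
move=> s; rewrite (@distance_up x y) // ?distance_refl ?addr0 // => z _.
by rewrite properE => /andP[].
Qed.

(** The way leads up to the smallest ball containing both leaves and down
    again. *)
Lemma distance_leaves i j : i != j -> i != rho -> j != rho ->
  distance cluster_len (node_leaf i : cluster_tree) (node_leaf j : cluster_tree)
   = height i j - radius (val (node_leaf i)) / 2 - radius (val (node_leaf j)) / 2.
Proof.
move=> ij ir jr; have [c iB jB hB min] := join_cluster ij ir jr.
pose B : node := exist _ (ball i (height i j)) c.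
have si : val (node_leaf i) \subset val B by apply: node_leaf_sub; rewrite /at_node (negbTE ir).
have sj : val (node_leaf j) \subset val B by apply: node_leaf_sub; rewrite /at_node (negbTE jr).
rewrite (@distance_up _ B) //.
  by rewrite distance_sym distance_above // hB; field.
move=> z sz pz; apply/negP => sw.
have iz : i \in val z by move/fintype.subsetP: sz; apply; apply: node_leaf_in.
have jz : j \in val z by move/fintype.subsetP: sw; apply; apply: node_leaf_in.
have := min _ (valP z) iz jz; by move: pz; rewrite properE => /andP[_ /negP].
Qed.

(** The tree of balls realises [height] up to a correction by the radii at
    which the leaves are attached, and [height] is the given vector up to the
    image of [Phi]. *)
Lemma four_point_support : moduli_support (quotv_pi (limg (Phi R n)) v).
Proof.
exists cluster_curve.
pose a : 'rV[R]_n := \row_i (if i == rho then - radius whole / 2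
  else at_pair i rho v + radius (val (node_leaf i)) / 2).
apply/eqP/pi_eqP; exists a; apply: at_pair_ext => i j ij.
rewrite linearD /= at_pair_Phi // at_pair_distance !mxE.
have leafrho : val (node_leaf rho) = whole by have := node_leaf_at rho; rewrite /at_node eqxx => /eqP.
have drho k : k != rho -> distance cluster_len (node_leaf k : cluster_tree) (node_leaf rho : cluster_tree) =
    (radius whole - radius (val (node_leaf k))) / 2.
  by move=> kr; rewrite distance_above leafrho // cluster_whole //; exact: valP.
have [iE|ir] := eqVneq i rho; have [jE|jr] := eqVneq j rho.
- by rewrite iE jE eqxx in ij.
- rewrite iE [distance _ _ _]distance_sym (drho j jr) (at_pairC rho); lra.
- rewrite jE (drho i ir); lra.
- rewrite [distance _ _ _]distance_leaves // /height; lra.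
Qed.

End Buneman.

(** * The lattice *)

Section IntegralSpan.
Variables (R : realType) (V : vectType R) (G : set V).

Lemma zspan_gen x : G x -> zspan G x.
Proof.
move=> Gx; exists [:: (1, x)]; split=> [y|]; last by rewrite big_seq1 mulr1z.
by rewrite inE => /eqP ->.
Qed.

Lemma zspan0 : zspan G 0.
Proof. by exists [::]; split=> //; rewrite big_nil. Qed.

Lemma zspanD x y : zspan G x -> zspan G y -> zspan G (x + y).
Proof.
move=> [s [sG ->]] [t [tG ->]]; exists (s ++ t); split; last by rewrite big_cat.
by move=> z; rewrite mem_cat => /orP[/sG|/tG].
Qed.

Lemma zspanMz x m : zspan G x -> zspan G (x *~ m).
Proof.
move=> [s [sG ->]]; exists [seq (y.1 * m, y.2) | y <- s]; split.
  by move=> y /mapP[z zs ->]; exact: (sG z zs).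
rewrite big_map /= mulrz_suml; apply: eq_bigr => y _; by rewrite mulrzA.
Qed.

Lemma zspan_sum (I : Type) (r : seq I) (P : pred I) (F : I -> V) :
  (forall i, P i -> zspan G (F i)) -> zspan G (\sum_(i <- r | P i) F i).
Proof. by move=> GF; elim/big_rec: _ => [|i x Pi Gx]; [exact: zspan0 | apply: zspanD => //; apply: GF]. Qed.

End IntegralSpan.

Section EvenVectors.
Variables (R : realType) (n : nat).
Implicit Types (v w : pair_space R n).

Notation pi := (quotv_pi (limg (Phi R n))).

Definition even_vec v := forall i j, (at_pair i j v : R) / 2 \is a Num.int.

(** This turns out to describe the lattice of the moduli space explicitly. *)
Definition even_class (x : moduli_space R n) := exists2 w, even_vec w & x = pi w.

Lemma even_class0 : even_class 0.
Proof. by exists 0; rewrite ?linear0 // => i j; rewrite linear0 mul0r int_num0. Qed.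

Lemma even_classD x y : even_class x -> even_class y -> even_class (x + y).
Proof.
move=> [v ev ->] [w ew ->]; exists (v + w); last by rewrite linearD.
by move=> i j; rewrite linearD mulrDl rpredD // ?ev ?ew.
Qed.

Lemma even_classMz x m : even_class x -> even_class (x *~ m).
Proof.
move=> [v ev ->]; exists (v *~ m); last by rewrite raddfMz.
by move=> i j; rewrite raddfMz -mulrzr mulrAC rpredM // ?ev // intr_int.
Qed.

Section SplitVector.
Variable T : combinatorial_type n.

Definition split_vec (E : {set T}) : pair_space R n := pair_vec (fun i j => (splits E i j)%:R).

Lemma splitsC (E : {set T}) i j : splits E i j = splits E j i.
Proof. by apply: sep_sym; apply: (@adj_sym _ T). Qed.

Lemma splitsxx (E : {set T}) i : splits E i i = false.
Proof. by rewrite /splits /separated connect0. Qed.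

Lemma at_split_vec (E : {set T}) i j : at_pair i j (split_vec E) = (splits E i j)%:R :> R.
Proof.
have [->|ij] := eqVneq i j; first by rewrite splitsxx at_pairxx.
by apply: at_pair_vec => // k l; rewrite splitsC.
Qed.

(** Adding the indicator function of one side at both leaves of a pair makes
    the entry 2 if a leaf of the pair is on that side, and 0 otherwise. *)
Lemma split_even E : E \in bounded_edges T -> even_class (pi (split_vec E)).
Proof.
move=> /splits_fun[phi phiE].
pose a : 'rV[R]_n := \row_i (phi i)%:R.
exists (split_vec E + Phi_fun a); last first.
  by apply/eqP; rewrite eq_sym; apply/pi_eqP; exists a.
move=> i j; rewrite linearD /=; have [->|ij] := eqVneq i j.
  by rewrite !at_pairxx addr0 mul0r int_num0.
rewrite at_pair_Phi // at_split_vec phiE !mxE.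
suff -> : ((phi i != phi j)%:R + ((phi i)%:R + (phi j)%:R)) / 2 = (phi i || phi j)%:R :> R.
  exact: rpred_nat.
by case: (phi i); case: (phi j) => /=; field.
Qed.

End SplitVector.

Lemma lattice_even x : moduli_lattice x -> even_class x.
Proof.
move=> [s [sG ->]]; elim: s sG => [|y s IH] sG; first by rewrite big_nil; apply: even_class0.
rewrite big_cons; apply: even_classD; last by apply: IH => z zs; apply: sG; rewrite inE zs orbT.
apply: even_classMz; have [C [card1 len1 ->]] := sG y (mem_head _ _).
have /cards1P[E EE] : #|bounded_edges C| == 1%N by rewrite card1.
have Ein : E \in bounded_edges C by rewrite EE set11.
rewrite /point_of /class_of (_ : distance_vector _ = split_vec E); first exact: split_even.
apply: at_pair_ext => i j _; rewrite at_split_vec at_distance_vector EE big_set1.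
by rewrite len1.
Qed.

End EvenVectors.

Section OneEdge.
Variables (R : realType) (n : nat) (i j k l : 'I_n).
Hypothesis ijkl : uniq [:: i; j; k; l].

(** The tree with one bounded edge, which separates [i] and [j] from all other
    leaves. *)
Definition pair_adj : rel bool := fun x y => x != y.
Definition pair_leaf (m : 'I_n) : bool := (m == i) || (m == j).

Lemma pair_adj_sym : symmetric pair_adj.
Proof. by move=> x y; rewrite /pair_adj eq_sym. Qed.

Lemma pair_adj_irr : irreflexive pair_adj.
Proof. by move=> x; rewrite /pair_adj eqxx. Qed.

Lemma pair_gt0 : (0 < #|{: bool}|)%N.
Proof. by rewrite card_bool. Qed.

Lemma pair_connected x y : connect pair_adj x y.
Proof.
have [->|nxy] := eqVneq x y; first exact: connect0.
exact: connect1.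
Qed.

Lemma pair_acyclic (c : seq bool) : ucycle pair_adj c -> (size c <= 2)%N.
Proof. by move=> /ucycle_uniq/card_uniqP <-; rewrite -card_bool max_card. Qed.

Lemma pair_valence x : (3 <= graph_valence pair_adj pair_leaf x)%N.
Proof.
move: ijkl; rewrite /= !inE !negb_or => /and4P[/and3P[ij ik il] /andP[jk jl] kl _].
case: x.
  apply: (@graph_valence_ge3 _ _ _ _ _ (inl false) (inr i) (inr j)) => //=.
  - by rewrite /pair_leaf eqxx.
  - by rewrite /pair_leaf eqxx orbT.
  - by rewrite !inE andbT; apply: contraNneq ij => -[->].
apply: (@graph_valence_ge3 _ _ _ _ _ (inl true) (inr k) (inr l)) => //=.
- by rewrite /pair_leaf ![k == _]eq_sym (negbTE ik) (negbTE jk).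
- by rewrite /pair_leaf ![l == _]eq_sym (negbTE il) (negbTE jl).
- by rewrite !inE andbT; apply: contraNneq kl => -[->].
Qed.

Definition pair_tree : combinatorial_type n :=
  CombinatorialType pair_adj_sym pair_adj_irr pair_gt0 pair_connected pair_acyclic pair_valence.

Lemma pair_curve_len (E : {set pair_tree}) : E \in bounded_edges pair_tree -> 0 < (fun=> 1 : R) E.
Proof. by []. Qed.

Definition pair_curve : curve R n := Curve pair_curve_len.

Lemma pair_curve_lattice : moduli_lattice (point_of pair_curve).
Proof.
apply: zspan_gen; exists pair_curve; split=> //.
apply/eqP/cards1P; exists [set: bool]%SET; apply/setP => E; rewrite !inE.
have full (p q : bool) : p != q -> [set p; q]%SET = [set: bool]%SET.
  by move=> npq; apply/setP => x; rewrite !inE; case: x p q npq => [] [] [].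
apply/(bounded_edgeP)/eqP => [[p [q [/= apq ->]]]|->]; first exact: full.
by exists true; exists false; rewrite full.
Qed.

Lemma pair_distance m m' :
  at_pair m m' (distance_vector (@len R n pair_curve)) = (pair_leaf m != pair_leaf m')%:R :> R.
Proof.
rewrite at_pair_distance.
have d0 (x : pair_tree) : distance (fun=> 1 : R) x x = 0.
  by rewrite distanceE big1 // => E _; rewrite /separated connect0.
rewrite /=; have [->|nm] := eqVneq; first exact: d0.
rewrite (@distance_step _ _ pair_tree _ _ (pair_leaf m')) ?d0 ?addr0 //; exact: sidexx.
Qed.

End OneEdge.

Section EvenLattice.
Variables (R : realType) (n : nat).
Hypothesis n_ge3 : (3 <= n)%N.

Notation pi := (quotv_pi (limg (Phi R n))).

Definition unit_vec (x : index_pair n) : pair_space R n := [ffun y => (y == x)%:R : R^o].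

Lemma at_unit_vec (x : index_pair n) (k l : 'I_n) : k != l ->
  at_pair k l (unit_vec x) =
   (((k == (sval x).1) || (k == (sval x).2)) && ((l == (sval x).1) || (l == (sval x).2)))%:R :> R.
Proof.
case: x => -[i j] /= ij kl.
have aux (a b : 'I_n) : (a < b)%N -> at_pair a b (unit_vec (exist _ (i, j) ij))
   = ((a == i) && (b == j))%:R :> R.
  by move=> ab; rewrite -(at_pairE _ (exist _ (a, b) ab)) ffunE.
have [lt|lt|/val_inj E] := ltngtP k l; last by rewrite E eqxx in kl.
  rewrite aux //; congr ((nat_of_bool _)%:R); apply/idP/idP => [/andP[-> ->]|]; first by rewrite orbT.
  by case/andP => /orP[]/eqP E1 /orP[]/eqP E2; move: lt (ij); rewrite E1 E2 ?eqxx ?ltnn //= => h1 h2; exfalso; lia.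
rewrite at_pairC aux //; congr ((nat_of_bool _)%:R); apply/idP/idP => [/andP[-> ->]|]; first by rewrite orbT.
by case/andP => /orP[]/eqP E1 /orP[]/eqP E2; move: lt (ij); rewrite E1 E2 ?eqxx ?ltnn //= => h1 h2; exfalso; lia.
Qed.

(** If [n > 3], the vector of the split of [i, j] from the rest is minus twice
    the unit vector, up to the image of [Phi].  If [n = 3], there are no bounded
    edges, but the quotient by the image of [Phi] is 0. *)
Lemma unit_lattice x : moduli_lattice (pi (2 *: unit_vec x)).
Proof.
set i := (sval x).1; set j := (sval x).2.
have ij : i != j by have := valP x; rewrite ltn_neqAle => /andP[].
have [n4|n3] := ltnP 3 n.
  have : (1 < #|~: [set i; j]|)%N by rewrite cardsCs finset.setCK card_ord cards2 ij; lia.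
  case/card_gt1P => k [l [kP lP kl]].
  have uq : uniq [:: i; j; k; l].
    move: kP lP; rewrite /= !inE !negb_or ij kl !(eq_sym i) !(eq_sym j).
    by move=> /andP[h1 h2] /andP[h3 h4]; rewrite h1 h2 h3 h4.
  have -> : pi (2 *: unit_vec x) = point_of (pair_curve R uq) *~ (-1).
    rewrite mulrNz mulr1z /point_of /class_of -linearN.
    pose a : 'rV[R]_n := \row_m ((m == i) || (m == j))%:R.
    apply/eqP/pi_eqP; exists a; apply: at_pair_ext => m m' mm.
    rewrite linearD linearN linearZ /= at_pair_Phi // pair_distance at_unit_vec // !mxE /pair_leaf -/i -/j.
    rewrite /GRing.scale /=.
    by case: (_ || _); case: (_ || _) => /=; ring.
  exact/zspanMz/pair_curve_lattice.
have -> : pi (2 *: unit_vec x) = 0; last exact: zspan0.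
pose a : 'rV[R]_n := \row_m (if (m == i) || (m == j) then 1 else -1).
apply/eqP; rewrite quotv_pi0; apply/Phi_imgP; exists a; apply: at_pair_ext => m m' mm.
rewrite linearZ /= at_pair_Phi // at_unit_vec // !mxE -/i -/j /GRing.scale /=.
have : ((m == i) || (m == j)) || ((m' == i) || (m' == j)).
  by have := ltn_ord i; have := ltn_ord j; have := ltn_ord m; have := ltn_ord m';
     move: mm ij; rewrite -!val_eqE /=; lia.
by case: ((m == i) || _); case: ((m' == i) || _) => //= _; ring.
Qed.

Lemma even_lattice (x : moduli_space R n) : even_class x -> moduli_lattice x.
Proof.
case=> w ew ->.
have -> : w = \sum_y (w y / 2) *: (2 *: unit_vec y).
  apply/ffunP => y; rewrite sum_ffunE (bigD1 y) //= big1 => [|z zy].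
    by rewrite !ffunE eqxx /GRing.scale /= addr0; field.
  by rewrite !ffunE eq_sym (negbTE zy) !scaler0.
rewrite linear_sum; apply: zspan_sum => y _.
have /intrP[m mE] : w y / 2 \is a Num.int by rewrite at_pairE; apply: ew.
by rewrite mE scaler_int raddfMz; apply/zspanMz/unit_lattice.
Qed.

End EvenLattice.

(** * Restriction, gluing and edge vectors *)

Lemma two_others m (a : 'I_m) : (3 <= m)%N -> exists x y, [/\ x != a, y != a & x != y].
Proof.
move=> m3; have : (1 < #|[set~ a]|)%N by rewrite finset.cardsC1 card_ord; lia.
by case/card_gt1P => x [y []]; rewrite !inE => xa ya xy; exists x; exists y.
Qed.

Section LocalStructure.
Variables (R : realType) (n : nat) (T : combinatorial_type n).
Implicit Types (v w : pair_space R n) (i j k l m : 'I_n) (p q : T).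

(** The linear conditions on a perturbation [v] of a tree metric on [T]: where
    the tree displays a quartet, the two larger sums must remain equal. *)
Definition tangent v := forall i j k l, resolved T i j k l ->
  at_pair i k v + at_pair j l v = at_pair i l v + at_pair j k v.

Lemma tangentD v w : tangent v -> tangent w -> tangent (v + w).
Proof. by move=> tv tw i j k l r; rewrite !linearD /= addrACA (tv _ _ _ _ r) (tw _ _ _ _ r) addrACA. Qed.

Lemma tangentZ c v : tangent v -> tangent (c *: v).
Proof. by move=> tv i j k l r; rewrite !linearZ /= -!mulrDr (tv _ _ _ _ r). Qed.

Lemma tangent0 : tangent 0.
Proof. by move=> i j k l _; rewrite !linear0. Qed.

Lemma tangent_sum (I : Type) (r : seq I) (P : pred I) (F : I -> pair_space R n) :
  (forall x, P x -> tangent (F x)) -> tangent (\sum_(x <- r | P x) F x).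
Proof. by move=> tF; elim/big_rec: _ => [|x y Px ty]; [exact: tangent0 | apply: tangentD => //; apply: tF]. Qed.

Lemma resolved_neq i j k l : resolved T i j k l -> [/\ i != k, i != l, j != k & j != l].
Proof.
case=> E EE; have [phi phiE] := splits_fun EE; rewrite !phiE => H.
by split; apply: contraTneq H => ->; do 4!case: (phi _).
Qed.

Lemma tangent_Phi (a : 'rV[R]_n) : tangent (Phi_fun a).
Proof.
move=> i j k l r; have [ik il jk jl] := resolved_neq r.
by rewrite !at_pair_Phi //; ring.
Qed.

Lemma valence_gt2 p : (3 <= valence p)%N.
Proof. exact: valence_ge3. Qed.

Definition restr p v : pair_space R (valence p) :=
  pair_vec (fun a b => at_pair (rep a) (rep b) v).

Lemma at_restr p (a b : 'I_(valence p)) v :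
  a != b -> at_pair a b (restr p v) = at_pair (rep a) (rep b) v.
Proof.
move=> ab; apply: (at_pair_vec (g := fun a b => at_pair (rep a) (rep b) v)) ab => c d.
exact: at_pairC.
Qed.

Lemma restr_linear p : linear (restr p).
Proof. by move=> c v w; apply/ffunP => ab; rewrite !ffunE linearP. Qed.

HB.instance Definition _ p :=
  GRing.isLinear.Build R (pair_space R n) (pair_space R (valence p)) _ (restr p) (restr_linear p).

Lemma restr_Phi p (a : 'rV[R]_n) : restr p (Phi_fun a) = Phi_fun (\row_x a 0 (rep (p := p) x)).
Proof.
apply: at_pair_ext => x y xy; rewrite at_restr // !at_pair_Phi ?mxE //.
by rewrite (inj_eq (@rep_inj _ T p)).
Qed.

Notation pi m := (quotv_pi (limg (Phi R m))).

Definition loc_fun p (w : moduli_space R n) : moduli_space R (valence p) :=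
  pi (valence p) (restr p (vsval w)).

Lemma loc_fun_linear p : linear (loc_fun p).
Proof. by move=> c v w; rewrite /loc_fun !linearP. Qed.

HB.instance Definition _ p :=
  GRing.isLinear.Build R (moduli_space R n) (moduli_space R (valence p)) _ (loc_fun p) (loc_fun_linear p).

(** The restriction of [Phi_fun a] is again of this form. *)
Lemma loc_pi p v : loc_fun p (pi n v) = pi (valence p) (restr p v).
Proof.
apply/eqP; rewrite /loc_fun quotv_pi_eq -linearB; have := vsval_quotv_pi (limg (Phi R n)) v.
by case/Phi_imgP => a /= ->; apply/Phi_imgP; rewrite restr_Phi; eexists.
Qed.

(** Seen from the other directions at [p], a leaf and the representative of its
    own direction differ by a constant, because the tree displays the quartets
    formed by them and two leaves in other directions. *)
Lemma direction_offset v p : tangent v -> exists b : 'I_n -> R, forall i j,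
  ldir p i != ldir p j ->
  at_pair i j v = at_pair (rep (ldir p i)) (rep (ldir p j)) v + b i + b j.
Proof.
move=> tv; pose other (x : 'I_(valence p)) := odflt x [pick y | y != x].
have otherP x : other x != x.
  rewrite /other; case: pickP => //= no; have [y [z [yx _ _]]] := two_others x (valence_gt2 p).
  by rewrite no in yx.
(* The quartet of [i], its representative, [m] and [m'] is displayed. *)
have star i m m' : ldir p m != ldir p i -> ldir p m' != ldir p i ->
    at_pair i m v - at_pair (rep (ldir p i)) m v
      = at_pair i m' v - at_pair (rep (ldir p i)) m' v.
  move=> dm dm'; have [iE|ni] := eqVneq i (rep (ldir p i)); first by rewrite -iE !subrr.
  have r : resolved T i (rep (ldir p i)) m m'.
    by apply: (same_direction_resolved ni _ dm dm'); rewrite repK.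
  by have := tv _ _ _ _ r; lra.
exists (fun i => at_pair i (rep (other (ldir p i))) v - at_pair (rep (ldir p i)) (rep (other (ldir p i))) v).
move=> i j nij.
have E1 := star i j (rep (other (ldir p i))); have E2 := star j (rep (ldir p i)) (rep (other (ldir p j))).
rewrite !repK in E1 E2; rewrite -E1 -?E2 // 1?eq_sym //.
rewrite (at_pairC j) (at_pairC (rep (ldir p j))).
by rewrite addrC addrA subrK addrC subrK.
Qed.

(** Each pair of leaves is seen from [p]; pairs in a common direction get the
    value 0. *)
Definition glue p (u : pair_space R (valence p)) : pair_space R n :=
  pair_vec (fun i j => at_pair (ldir p i) (ldir p j) u).

Lemma at_glue p u i j : at_pair i j (glue (p := p) u) = at_pair (ldir p i) (ldir p j) u.
Proof.
have [->|ij] := eqVneq i j; first by rewrite !at_pairxx.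
apply: (at_pair_vec (g := fun i j => at_pair (ldir p i) (ldir p j) u)) ij => k l.
exact: at_pairC.
Qed.

Lemma tangent_glue p u : tangent (glue (p := p) u).
Proof.
move=> i j k l [E EE H]; rewrite !at_glue.
have [f [fE _ fdir]] := edge_direction EE; have [a aP] := fdir p.
move: H; rewrite !fE !negbK => /and3P[/eqP eij /eqP ekl neik].
have [ei|ni] := eqVneq (f (leaf T i)) (f p).
  have nk : f (leaf T k) != f p by rewrite -ei eq_sym.
  by rewrite (aP k) // (aP l) // -ekl.
by rewrite (aP i) // (aP j) -?eij // addrC.
Qed.

Lemma restr_glue p u : restr p (glue u) = u.
Proof. by apply: at_pair_ext => a b ab; rewrite at_restr // at_glue !repK. Qed.

(** All leaves that [q] does not see in the direction of [p] are seen from [p] in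
    one direction, so only the entries at the direction of [p] can be non-zero:
    they form a potential supported there. *)
Lemma loc_glue_other p q u : p != q -> pi (valence q) (restr q (glue (p := p) u)) = 0.
Proof.
move=> npq; have [a [b abP]] := ldir_other npq.
apply/eqP; rewrite quotv_pi0; apply/Phi_imgP.
exists (\row_c (if c == b then at_pair (ldir p (rep b)) a u else 0)).
apply: at_pair_ext => c d cd; rewrite at_restr // at_glue at_pair_Phi // !mxE.
have [cb|cb] := eqVneq c b; have [db|db] := eqVneq d b.
- by rewrite cb db eqxx in cd.
- by rewrite cb (abP (rep d)) ?repK // addr0.
- by rewrite db (abP (rep c)) ?repK // add0r at_pairC.
- by rewrite !abP ?repK // at_pairxx addr0.
Qed.

Lemma even_glue p u : even_vec u -> even_vec (glue (p := p) u).
Proof. by move=> eu i j; rewrite at_glue. Qed.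

Lemma even_restr p v : even_vec v -> even_vec (restr p v).
Proof.
move=> ev a b; have [->|ab] := eqVneq a b; first by rewrite at_pairxx mul0r int_num0.
by rewrite at_restr.
Qed.

Lemma tangent_split (E : {set T}) : E \in bounded_edges T -> tangent (split_vec R E).
Proof.
move=> EE i j k l r; rewrite !at_split_vec -!natrD; congr (_%:R).
have [phi phiE] := splits_fun EE.
have n1 : ~~ [&& ~~ splits E i k, ~~ splits E j l & splits E i j].
  by apply/negP => H; apply: (resolved_compat r); exists E.
have n2 : ~~ [&& ~~ splits E i l, ~~ splits E j k & splits E i j].
  apply/negP => H; case: r => E' EE'; have [psi psiE] := splits_fun EE' => H'.
  apply: (@resolved_compat _ T i j l k); [exists E' | exists E] => //.
  by move: H'; rewrite !psiE; do 4!case: (psi _).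
by move: n1 n2; rewrite !phiE; do 4!case: (phi _).
Qed.

(** From [p], an edge separates one direction from all the others, or nothing:
    its split vector restricts to a potential. *)
Lemma loc_split p (E : {set T}) : E \in bounded_edges T ->
  pi (valence p) (restr p (split_vec R E)) = 0.
Proof.
move=> EE; have [f [fE _ fdir]] := edge_direction EE; have [a aP] := fdir p.
apply/eqP; rewrite quotv_pi0; apply/Phi_imgP.
exists (\row_c (f (leaf T (rep c)) != f p)%:R).
apply: at_pair_ext => c d cd; rewrite at_restr // at_split_vec at_pair_Phi // !mxE fE.
have : ~ (f (leaf T (rep c)) != f p /\ f (leaf T (rep d)) != f p).
  by case=> /aP + /aP; rewrite !repK => cE dE; rewrite cE dE eqxx in cd.
have [->|nc] := eqVneq (f (leaf T (rep c))) (f p); first by rewrite add0r eq_sym.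
have [->|nd] := eqVneq (f (leaf T (rep d))) (f p); first by rewrite nc addr0.
by move=> H; exfalso; apply: H.
Qed.

(** Four leaves, two leaving the edge at each of its ends in different
    directions, from which the length of the edge can be read off. *)
Record edge_quad (E : {set T}) (p q : T) i j k l : Prop := EdgeQuad {
  quad_adj : adj T p q;
  quad_edge : E = [set p; q]%SET;
  quad_ij : ldir p i != ldir p j;
  quad_ik : ldir p i != ldir p k;
  quad_jk : ldir p j != ldir p k;
  quad_pkl : ldir p k = ldir p l;
  quad_kl : ldir q k != ldir q l;
  quad_ki : ldir q k != ldir q i;
  quad_li : ldir q l != ldir q i;
  quad_qij : ldir q i = ldir q j }.

Lemma edge_quad_ex (E : {set T}) : E \in bounded_edges T ->
  exists p q i j k l, edge_quad E p q i j k l.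
Proof.
case/bounded_edgeP => p [q [apq ->]]; exists p; exists q.
have [a [b [aP bP _]]] := edge_ends apq.
have [x [y [xa ya xy]]] := two_others a (valence_gt2 p).
have [z [t [zb tb zt]]] := two_others b (valence_gt2 q).
have ab m : (ldir q m == b) = (ldir p m != a) by rewrite bP aP.
have pb m : ldir q m != b -> ldir p m = a by rewrite ab negbK => /eqP.
have qa m : ldir p m != a -> ldir q m = b by rewrite -ab => /eqP.
exists (rep x); exists (rep y); exists (rep z); exists (rep t).
have px : ldir q (rep x) = b by rewrite qa ?repK.
have py : ldir q (rep y) = b by rewrite qa ?repK.
have qz : ldir p (rep z) = a by rewrite pb ?repK.
have qt : ldir p (rep t) = a by rewrite pb ?repK.
by split; rewrite ?repK ?px ?py ?qz ?qt ?repK.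
Qed.

(** No other edge separates these two pairs of leaves: such an
    edge would separate the two ends. *)
Lemma quad_coord_split (E E' : {set T}) p q i j k l : E' \in bounded_edges T ->
  edge_quad E p q i j k l ->
  ((splits E' i k)%:R + (splits E' j l)%:R - (splits E' i j)%:R - (splits E' k l)%:R) / 2
    = (E' == E)%:R :> R.
Proof.
move=> EE' [apq EE ij ik jk pkl kl ki li qij].
have [E'E|nE] := eqVneq E' E.
  have [a [b [aP bP sE]]] := edge_ends apq; rewrite E'E EE !sE.
  have ab m : (ldir q m == b) = (ldir p m != a) by rewrite bP aP.
  have iF : (ldir p i == a) = false.
    apply/negP => ia; have := ab i; rewrite ia => /negbT qi.
    have ka : ldir p k != a by move/eqP: ia ik => ->; rewrite eq_sym.
    have la : ldir p l != a by rewrite -pkl.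
    by rewrite -!ab in ka la; rewrite (eqP ka) (eqP la) eqxx in kl.
  have kT : ldir p k == a.
    by apply: contraT; rewrite -ab => /eqP kb; move: ki; rewrite kb eq_sym ab iF.
  have jF : (ldir p j == a) = false by rewrite -(eqP kT); apply: negbTE.
  by rewrite -pkl iF kT jF /=; field.
have [f [fE fadj fdir]] := edge_direction EE'.
have fpq : f p = f q by apply: fadj => //; rewrite -EE eq_sym.
have [a aP] := fdir p; have [b bP] := fdir q.
(* At [p] the leaves [i], [j] and the pair [k, l] have different directions, so
   at most one of them is beyond [E']; similarly at [q]. *)
have nij : ~ (f (leaf T i) != f p /\ f (leaf T j) != f p).
  by case=> /aP Ei /aP Ej; rewrite Ei Ej eqxx in ij.
have nkl : ~ (f (leaf T k) != f p /\ f (leaf T l) != f p).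
  by rewrite fpq; case=> /bP Ek /bP El; rewrite Ek El eqxx in kl.
have nik : ~ (f (leaf T i) != f p /\ f (leaf T k) != f p).
  by case=> /aP Ei /aP Ek; rewrite Ei Ek eqxx in ik.
have njl : ~ (f (leaf T j) != f p /\ f (leaf T l) != f p).
  by case=> /aP Ej /aP El; rewrite Ej pkl El eqxx in jk.
rewrite !fE; move: nij nkl nik njl.
by case: (f _); case: (f _); case: (f _); case: (f _); case: (f _) => /= h1 h2 h3 h4;
  first [by case: h1 | by case: h2 | by case: h3 | by case: h4 | field].
Qed.

End LocalStructure.

(** * Local coordinates at a tree *)

Section Coordinates.
Variables (R : realType) (n : nat) (T : combinatorial_type n).
Implicit Types (v w : pair_space R n) (i j k l m : 'I_n) (p q : T).
Notation pi m := (quotv_pi (limg (Phi R m))).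
Notation nedges := #|bounded_edges T|.

Definition edge_of (e : 'I_nedges) : {set T} := enum_val e.

Lemma edge_ofP e : edge_of e \in bounded_edges T. Proof. exact: enum_valP. Qed.

Lemma quad_subproof e : exists x : (T * T) * (('I_n * 'I_n) * ('I_n * 'I_n)),
  edge_quad (edge_of e) x.1.1 x.1.2 x.2.1.1 x.2.1.2 x.2.2.1 x.2.2.2.
Proof.
have [p [q [i [j [k [l H]]]]]] := edge_quad_ex (edge_ofP e).
by exists ((p, q), ((i, j), (k, l))).
Qed.

Definition quad_of e := sval (cid (quad_subproof e)).

Lemma quad_ofP e : edge_quad (edge_of e) (quad_of e).1.1 (quad_of e).1.2
  (quad_of e).2.1.1 (quad_of e).2.1.2 (quad_of e).2.2.1 (quad_of e).2.2.2.
Proof. exact: svalP (cid (quad_subproof e)). Qed.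

(** On a tree metric these are the lengths of the bounded edges
    ([edge_coord_split]). *)
Definition edge_coord v : 'rV[R]_nedges :=
  \row_e let: ((i, j), (k, l)) := (quad_of e).2 in
    (at_pair i k v + at_pair j l v - at_pair i j v - at_pair k l v) / 2.

Lemma edge_coord_linear : linear edge_coord.
Proof.
move=> c v w; apply/rowP => e; rewrite !mxE; case: (quad_of e).2 => -[i j] [k l].
rewrite !linearP /= /GRing.scale /=; ring.
Qed.

HB.instance Definition _ :=
  GRing.isLinear.Build R (pair_space R n) 'rV[R]_nedges _ edge_coord edge_coord_linear.

Lemma edge_coord_Phi (a : 'rV[R]_n) : edge_coord (Phi_fun a) = 0.
Proof.
apply/rowP => e; rewrite !mxE; have := quad_ofP e.
case: (quad_of e) => -[p q] [[i j] [k l]] /= [_ _ ij ik jk pkl kl _ _ _].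
have neq (x y : 'I_n) (r : T) : ldir r x != ldir r y -> x != y by apply: contraNneq => ->.
rewrite !at_pair_Phi ?(neq _ _ _ ij) ?(neq _ _ _ ik) ?(neq _ _ _ kl) //; last first.
  by rewrite pkl in jk; rewrite (neq _ _ _ jk).
by field.
Qed.

Lemma edge_coord_split e : edge_coord (split_vec R (edge_of e)) = delta_mx 0 e.
Proof.
apply/rowP => e'; rewrite !mxE; have := quad_ofP e'.
case: (quad_of e') => -[p q] [[i j] [k l]] /= Q.
rewrite !at_split_vec (quad_coord_split R (edge_ofP e) Q) /edge_of.
by rewrite (inj_eq enum_val_inj) eq_sym.
Qed.

Lemma edge_coord_even v : even_vec v -> forall e, edge_coord v 0 e \is a Num.int.
Proof.
move=> ev e; rewrite mxE; case: (quad_of e).2 => -[i j] [k l].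
by rewrite !mulrBl mulrDl rpredB ?rpredB ?rpredD ?ev.
Qed.

(** Gluing produces the prescribed restrictions; adding multiples of the split
    vectors then adjusts the edge coordinates without changing the
    restrictions.  Integrality is preserved in both steps. *)
Lemma local_lift (c : 'rV[R]_nedges) (u : forall p, pair_space R (valence p)) :
  exists v, [/\ tangent T v, edge_coord v = c,
    forall p, pi (valence p) (restr p v) = pi (valence p) (u p) &
    (forall p, even_vec (u p)) -> (forall e, c 0 e \is a Num.int) -> even_class (pi n v)].
Proof.
pose v0 : pair_space R n := \sum_(p : T) glue (u p).
pose s : pair_space R n := \sum_e (c 0 e - edge_coord v0 0 e) *: split_vec R (edge_of e).
have cs : edge_coord s = c - edge_coord v0.
  rewrite /s linear_sum [RHS]row_sum_delta; apply: eq_bigr => e _.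
  by rewrite linearZ /= edge_coord_split !mxE.
exists (v0 + s); split.
- apply: tangentD; first by apply: tangent_sum => p _; apply: tangent_glue.
  by apply: tangent_sum => e _; apply: tangentZ; apply: tangent_split; apply: edge_ofP.
- by rewrite linearD /= cs addrC subrK.
- move=> p; rewrite linearD /= linearD /= /v0 /s !linear_sum /= ?linear_sum /=.
  rewrite [X in _ + X]big1 ?addr0 => [|e _]; last first.
    by rewrite !linearZ /= loc_split ?scaler0 //; apply: edge_ofP.
  rewrite (bigD1 p) //= restr_glue big1 ?addr0 // => q nqp.
  exact: loc_glue_other.
move=> eu ic; have ev0 : even_vec v0.
  move=> i j; rewrite /v0 linear_sum mulr_suml rpred_sum // => p _.
  exact: even_glue.
rewrite linearD; apply: even_classD; first by exists v0.
rewrite /s linear_sum; elim/big_rec: _ => [|e x _ ex]; first exact: even_class0.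
apply: even_classD => //; rewrite linearZ /=.
have /intrP[z ->] : c 0 e - edge_coord v0 0 e \is a Num.int.
  by rewrite rpredB //; apply: edge_coord_even.
by rewrite scaler_int; apply: even_classMz; apply: split_even; apply: edge_ofP.
Qed.

(** At each vertex [p] there is a potential [a] such that the entry at [i, j] is
    [a i + a j] whenever [p] separates [i] from [j].  Across an edge the two
    potentials differ by a constant on one side and by its opposite on the
    other, and the edge coordinate is a multiple of this constant.  As it
    vanishes, all potentials agree; any two leaves are separated by the vertex
    at which one of them starts. *)
Lemma local_injective v : tangent T v -> edge_coord v = 0 ->
  (forall p, pi (valence p) (restr p v) = 0) -> pi n v = 0.
Proof.
move=> tv cv rv.
(* The potentials at the vertices. *)
have pot p : exists a : 'I_n -> R, forall i j, ldir p i != ldir p j ->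
    at_pair i j v = a i + a j :> R.
  have /eqP := rv p; rewrite quotv_pi0 => /Phi_imgP[a aE].
  have [b bE] := direction_offset p tv.
  exists (fun i => a 0 (ldir p i) + b i) => i j nij.
  by rewrite bE // -at_restr // aE at_pair_Phi //; ring.
pose al p := sval (cid (pot p)).
have alP p i j : ldir p i != ldir p j -> at_pair i j v = al p i + al p j :> R.
  exact: (svalP (cid (pot p))).
have step e i : al (quad_of e).1.1 i = al (quad_of e).1.2 i.
  have ce : edge_coord v 0 e = 0 by rewrite cv mxE.
  move: ce; rewrite mxE; have := quad_ofP e.
  case: (quad_of e) => -[p q] [[i0 j0] [k0 l0]] /= [apq EE ij ik jk pkl kl ki li qij].
  have [a [b [aP bP _]]] := edge_ends apq.
  have ab m : (ldir q m == b) = (ldir p m != a) by rewrite bP aP.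
  have cross x y : ldir p x != a -> ldir p y = a -> al p x + al p y = al q x + al q y.
    move=> xa ya; rewrite -!alP ?ya //.
    have qx : ldir q x == b by rewrite ab.
    have qy : ldir q y != b by rewrite ab ya eqxx.
    by rewrite (eqP qx) eq_sym.
  have iF : ldir p i0 != a.
    apply/negP => /eqP ia; have ka : ldir p k0 != a by rewrite -ia eq_sym.
    have la : ldir p l0 != a by rewrite -pkl.
    by rewrite -!ab in ka la; rewrite (eqP ka) (eqP la) eqxx in kl.
  have kT : ldir p k0 = a.
    apply/eqP; apply: contraT; rewrite -ab => /eqP kb.
    by move: ki iF; rewrite kb -ab eq_sym => /negbTE ->.
  have jF : ldir p j0 != a by rewrite -kT.
  have lT : ldir p l0 = a by rewrite -pkl.
  have lj : ldir p l0 != ldir p j0 by rewrite lT eq_sym.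
  have -> : at_pair i0 k0 v = al p i0 + al p k0 :> R by apply: alP; rewrite kT.
  have -> : at_pair j0 l0 v = al p j0 + al p l0 :> R by apply: alP; rewrite lT.
  have -> : at_pair i0 j0 v = al p i0 + al p j0 :> R by apply: alP.
  have -> : at_pair k0 l0 v = al q k0 + al q l0 :> R by apply: alP.
  have h1 := cross _ _ iF kT; have h2 := cross _ _ iF lT; move=> h3.
  have [/eqP ia|na] := boolP (ldir p i == a).
    by have := cross _ _ iF ia; lra.
  by have := cross _ _ na kT; lra.
(* [quad_of] may list the ends of the edge in either order. *)
have nb x y : adj T x y -> forall i, al x i = al y i.
  move=> axy i; have EE : [set x; y]%SET \in bounded_edges T.
    by apply/bounded_edgeP; exists x; exists y.
  have := step (enum_rank_in EE [set x; y]%SET) i.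
  have := quad_edge (quad_ofP (enum_rank_in EE [set x; y]%SET)).
  by rewrite /edge_of enum_rankK_in // => /set2_cases[][<- <-].
have /card_gt0P[p0 _] := vertex_gt0 T.
have glob p i : al p i = al p0 i.
  have : [forall i, al p i == al p0 i].
    apply: (closed_full (@adj_connected _ T) (A := fun p => [forall i, al p i == al p0 i]) (u := p0)).
      move=> x y /forallP H axy; apply/forallP => m; by rewrite -(nb _ _ axy).
    by apply/forallP => m.
  by move/forallP/(_ i)/eqP.
apply/eqP; rewrite quotv_pi0; apply/Phi_imgP; exists (\row_i al p0 i).
apply: at_pair_ext => i j ij; rewrite at_pair_Phi // !mxE -!(glob (leaf T i)).
by apply: alP; apply: ldir_leaf.
Qed.

End Coordinates.

(** * The local cone at a curve *)

Section SmallParameters.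
Variable R : realFieldType.

Lemma small_lt (a b s t : R) : a < b -> exists2 e, 0 < e & forall x, 0 <= x -> x <= e -> a + x * s <= b + x * t.
Proof.
move=> ab; exists ((b - a) / (1 + `|s - t|)).
  by rewrite divr_gt0 ?subr_gt0 // ltr_pwDl.
move=> x x0; rewrite ler_pdivlMr ?ltr_pwDl // => H.
have : x * (s - t) <= x * `|s - t| by rewrite ler_wpM2l // ler_norm.
by move=> H'; nra.
Qed.

Lemma small_seq (I : eqType) (s : seq I) (P : I -> R -> Prop) :
  (forall i, i \in s -> exists2 e, 0 < e & forall x, 0 <= x -> x <= e -> P i x) ->
  exists2 e, 0 < e & forall i, i \in s -> forall x, 0 <= x -> x <= e -> P i x.
Proof.
elim: s => [|i s IH] H; first by exists 1.
have [k ks|e e0 eP] := IH; first by apply: H; rewrite inE ks orbT.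
have [d dd dP] := H i (mem_head _ _); exists (Num.min d e); first by rewrite lt_min dd.
move=> k; rewrite inE => /orP[/eqP ->|ks] x x0'; rewrite le_min => /andP[xd xe].
  exact: dP.
exact: eP.
Qed.

Lemma small_fin (I : finType) (P : I -> R -> Prop) :
  (forall i, exists2 e, 0 < e & forall x, 0 <= x -> x <= e -> P i x) ->
  exists2 e, 0 < e & forall i x, 0 <= x -> x <= e -> P i x.
Proof.
move=> H; have [//|e e0 eP] := @small_seq I (enum I) P.
by exists e => // i; apply: eP; rewrite mem_enum.
Qed.

End SmallParameters.

(** With all entries at a leaf [rho] normalised to 0, each of the three entries
    of a triangle is at most the maximum and at least the minimum of the two
    others, so they are equal: the normalised vector is constant, hence in the
    image of [Phi]. *)
Lemma four_point_pointed (R : realType) (n : nat) (u : pair_space R n) : (3 <= n)%N ->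
  four_point u -> four_point (- u) -> quotv_pi (limg (Phi R n)) u = 0.
Proof.
move=> n3 fp fn; pose rho : 'I_n := Ordinal (leq_trans (ltn0Sn 2) n3).
have [s [t [sr tr st]]] := two_others rho n3.
have [h hE] : exists h : 'I_n -> 'I_n -> R, forall i j, h i j = height u rho i j by eexists.
have hC i j : h i j = h j i by rewrite !hE heightC.
have tri i j k : uniq [:: i; j; k; rho] -> h i j = h i k.
  rewrite /= !inE !negb_or => /and4P[/and3P[ij ik ir] /andP[jk jr] kr _].
  have ul a b c : a != b -> a != c -> b != c -> a != rho -> b != rho -> c != rho ->
      (h a b <= h a c \/ h a b <= h b c) /\ (h a c <= h a b \/ h b c <= h a b).
    move=> ab ac bc ar br cr.
    have uq : uniq [:: a; b; c; rho] by rewrite /= !inE !negb_or ab ac bc ar br cr.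
    have := fn _ _ _ _ uq; have := fp _ _ _ _ uq; rewrite !linearN /= !hE /height !le_max.
    by move=> /orP H1 /orP H2; split; [case: H1|case: H2] => H; [left|right|left|right]; lra.
  have [a1 a2] := ul i j k ij ik jk ir jr kr.
  have [b1 b2] : (h i k <= h i j \/ h i k <= h k j) /\ (h i j <= h i k \/ h k j <= h i k).
    by apply: ul => //; rewrite eq_sym.
  rewrite (hC k) in b1 b2; move: (h i j) (h i k) (h j k) a1 a2 b1 b2 => a b c.
  by move=> [] ? [] ? [] ? [] ?; lra.
have const i j : i != j -> i != rho -> j != rho -> h i j = h s t.
  move=> ij ir jr.
  have hs k : k != s -> k != rho -> h s k = h s t.
    move=> ks kr; have [->//|kt] := eqVneq k t.
    by apply: tri; rewrite /= !inE !negb_or eq_sym ks st sr kt kr tr.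
  have [E|js] := eqVneq j s; first by rewrite E hC; apply: hs; rewrite // -E.
  have [->|is_] := eqVneq i s; first exact: hs.
  rewrite hC -(hs j js jr) (hC s); apply: tri.
  by rewrite /= !inE !negb_or eq_sym ij js jr is_ ir sr.
apply/eqP; rewrite quotv_pi0; apply/Phi_imgP.
exists (\row_i (if i == rho then - (h s t) / 2 else at_pair i rho u + h s t / 2)).
apply: at_pair_ext => i j ij; rewrite at_pair_Phi // !mxE.
have [iE|ir] := eqVneq i rho; have [jE|jr] := eqVneq j rho.
- by rewrite iE jE eqxx in ij.
- rewrite iE (at_pairC rho); lra.
- rewrite jE; lra.
- by have := const i j ij ir jr; rewrite [h i j]hE /height; lra.
Qed.

(** The directions at any vertex have different representatives. *)
Lemma leaves_ge3 n (T : combinatorial_type n) : (3 <= n)%N.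
Proof.
have /card_gt0P[p _] := vertex_gt0 T.
have := leq_card _ (@rep_inj n T p); rewrite !card_ord; apply: leq_trans.
exact: valence_gt2.
Qed.

Lemma support_iff (R : realType) n (v : pair_space R n) : (3 <= n)%N ->
  moduli_support (quotv_pi (limg (Phi R n)) v) <-> four_point v.
Proof.
move=> n3; split; first exact: support_four_point.
by move=> fp; apply: (four_point_support (Ordinal (leq_trans (ltn0Sn 2) n3))).
Qed.

Section LocalFourPoint.
Variables (R : realType) (n : nat) (T : combinatorial_type n) (v : pair_space R n).
Hypothesis tv : tangent T v.

Definition local_four_point := forall i j k l, uniq [:: i; j; k; l] ->
  ~ resolved T i j k l -> ~ resolved T i k j l -> ~ resolved T i l j k ->
  at_pair i j v + at_pair k l v
    <= Num.max (at_pair i k v + at_pair j l v) (at_pair i l v + at_pair j k v).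

(** Passing from leaves to the representatives of their directions adds the same
    amount to all three sums ([direction_offset]). *)
Lemma local_four_pointP : local_four_point <-> forall p : T, four_point (restr p v).
Proof.
split=> [lf p a b c d uq|fp i j k l uq n1 n2 n3].
  have := uq; rewrite /= !inE !negb_or => /and4P[/and3P[ab ac ad] /andP[bc bd] cd _].
  rewrite !at_restr //; apply: lf.
  - by rewrite -[[:: rep a; _; _; _]]/(map (@rep _ T p) [:: a; b; c; d]) map_inj_uniq //; apply: rep_inj.
  - by apply: (distinct_unresolved (p := p)); rewrite !repK.
  - apply: (distinct_unresolved (p := p)); rewrite !repK.
    by rewrite /= !inE !negb_or ab ac ad cd bd eq_sym bc.
  - apply: (distinct_unresolved (p := p)); rewrite !repK.
    by rewrite /= !inE !negb_or ab ac ad bc eq_sym bd eq_sym cd.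
have [p up] := unresolved_vertex uq n1 n2 n3.
have := fp p _ _ _ _ up; have := up.
rewrite /= !inE !negb_or => /and4P[/and3P[ij ik il] /andP[jk jl] kl _].
have [b bE] := direction_offset p tv.
rewrite !at_restr // (bE i j) // (bE k l) // (bE i k) // (bE j l) // (bE i l) // (bE j k) //.
have sum1 (x y b1 b2 b3 b4 : R) : x + b1 + b2 + (y + b3 + b4) = x + y + (b1 + b2 + b3 + b4) by ring.
have sum2 (x y b1 b2 b3 b4 : R) : x + b1 + b3 + (y + b2 + b4) = x + y + (b1 + b2 + b3 + b4) by ring.
have sum3 (x y b1 b2 b3 b4 : R) : x + b1 + b4 + (y + b2 + b3) = x + y + (b1 + b2 + b3 + b4) by ring.
rewrite (sum1 _ _ (b i) (b j) (b k) (b l)) (sum2 _ _ (b i) (b j) (b k) (b l)) (sum3 _ _ (b i) (b j) (b k) (b l)).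
by rewrite !le_max !lerD2r.
Qed.

End LocalFourPoint.

Section LocalCone.
Variables (R : realType) (n : nat) (C : curve R n).
Notation pi := (quotv_pi (limg (Phi R n))).
Notation d0 := (distance_vector (@len R n C)).

Lemma tangent_pi (v w : pair_space R n) : pi v = pi w -> tangent C v -> tangent C w.
Proof. by move=> /esym/eqP/pi_eqP[a ->] tv; apply: tangentD => //; apply: tangent_Phi. Qed.

Lemma distance_unresolved_eq i j k l : ~ resolved C i j k l -> ~ resolved C i k j l ->
  at_pair i j d0 + at_pair k l d0 = at_pair i k d0 + at_pair j l d0 :> R.
Proof.
move=> n1 n2; have le0 : forall E, E \in bounded_edges C -> 0 <= len E by move=> E /len_gt0/ltW.
by apply/eqP; rewrite eq_le (distance_le le0 n2) (distance_le le0 n1).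
Qed.

Lemma resolved_sym i j k l : resolved C i j k l -> resolved C i j l k.
Proof.
case=> E EE; have [phi phiE] := splits_fun EE; rewrite !phiE => H; exists E => //.
by rewrite !phiE; move: H; do 4!case: (phi _).
Qed.

Lemma tangent_distance : tangent C d0.
Proof.
move=> i j k l r; have r' := resolved_sym r.
have n1 : ~ resolved C i k j l by apply: resolved_compat r.
have n2 : ~ resolved C i l j k by apply: resolved_compat r'.
have := distance_unresolved_eq (i := i) (j := k) (k := l) (l := j).
rewrite (at_pairC l j) (at_pairC k j); apply => /resolved_sym; [exact: n1 | exact: n2].
Qed.

(** Along displayed quartets one sum stays strictly smaller and the two others
    stay equal; along the remaining ones the three sums start from a common
    value. *)
Lemma local_cone_open (v : pair_space R n) : tangent C v -> local_four_point C v ->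
  exists2 e, 0 < e & forall x, 0 <= x -> x <= e -> four_point (d0 + x *: v).
Proof.
move=> tv lv; pose I : finType := ('I_n * 'I_n * ('I_n * 'I_n))%type.
have [|e e0 eP] := @small_fin R I (fun q x => uniq [:: q.1.1; q.1.2; q.2.1; q.2.2] ->
   at_pair q.1.1 q.1.2 (d0 + x *: v) + at_pair q.2.1 q.2.2 (d0 + x *: v)
    <= Num.max (at_pair q.1.1 q.2.1 (d0 + x *: v) + at_pair q.1.2 q.2.2 (d0 + x *: v))
       (at_pair q.1.1 q.2.2 (d0 + x *: v) + at_pair q.1.2 q.2.1 (d0 + x *: v))); last first.
  by exists e => // x x0 xe i j k l uq; apply: (eP ((i, j), (k, l))).
case=> -[i j] [k l] /=.
have lin x a b : at_pair a b (d0 + x *: v) = at_pair a b d0 + x * at_pair a b v :> R.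
  by rewrite linearD linearZ.
have [r|n1] := pselect (resolved C i j k l).
  have [e e0 eP] := small_lt (at_pair i j v + at_pair k l v) (at_pair i k v + at_pair j l v) (distance_lt r).
  exists e => // x x0 xe _; rewrite le_max !lin; apply/orP; left.
  by have := eP x x0 xe; lra.
have [r|n2] := pselect (resolved C i k j l).
  exists 1 => // x x0 _ _; rewrite le_max !lin; apply/orP; right.
  have := tv _ _ _ _ r; have := tangent_distance r.
  rewrite !(at_pairC k j) => E1 E2.
  have E3 : x * (at_pair i j v + at_pair k l v) = x * (at_pair i l v + at_pair j k v) :> R.
    by congr (_ * _); exact: E2.
  by lra.
have [r|n3] := pselect (resolved C i l j k).
  exists 1 => // x x0 _ _; rewrite le_max !lin; apply/orP; left.
  have := tv _ _ _ _ r; have := tangent_distance r.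
  rewrite !(at_pairC l k) !(at_pairC l j) => E1 E2.
  have E3 : x * (at_pair i j v + at_pair k l v) = x * (at_pair i k v + at_pair j l v) :> R.
    by congr (_ * _); exact: E2.
  by lra.
exists 1 => // x x0 _ uq; rewrite !lin.
have E1 := distance_unresolved_eq n1 n2.
have E2 : at_pair i j d0 + at_pair k l d0 = at_pair i l d0 + at_pair j k d0 :> R.
  have := distance_unresolved_eq (i := i) (j := j) (k := l) (l := k).
  by rewrite (at_pairC l k); apply=> [/resolved_sym|]; [exact: n1 | exact: n3].
have := lv _ _ _ _ uq n1 n2 n3; rewrite !le_max => /orP[] h; apply/orP; [left|right].
  have h' : x * (at_pair i j v + at_pair k l v) <= x * (at_pair i k v + at_pair j l v) by rewrite ler_wpM2l.
  lra.
have h' : x * (at_pair i j v + at_pair k l v) <= x * (at_pair i l v + at_pair j k v) by rewrite ler_wpM2l.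
lra.
Qed.

(** For small [x] the first argument of the maximum is too small to matter. *)
Lemma small_max (a b c s t u e0 : R) : 0 < e0 -> a < b -> b = c ->
  (forall x, 0 < x -> x <= e0 -> b + x * t <= Num.max (a + x * s) (c + x * u)) -> t <= u.
Proof.
move=> e00 ab bc H; rewrite leNgt; apply/negP => ut.
have [e e1 eP] := small_lt s (t - (t - u) / 2) ab.
have x0 : 0 < Num.min e0 e by rewrite lt_min e00.
have := H _ x0; rewrite ge_min lexx => /(_ isT).
have := eP _ (ltW x0); rewrite ge_min lexx orbT => /(_ isT).
move: (Num.min e0 e) x0 => x x0; rewrite le_max -bc => h /orP[] h'; last first.
  by move: h'; rewrite lerD2l ler_pM2l // leNgt ut.
have : 0 < x * ((t - u) / 2) by rewrite mulr_gt0 // divr_gt0 // subr_gt0.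
move: h h'; nra.
Qed.

Lemma local_cone_necessary (v : pair_space R n) (e0 : R) : 0 < e0 ->
  (forall x, 0 < x -> x <= e0 -> four_point (d0 + x *: v)) ->
  tangent C v /\ local_four_point C v.
Proof.
move=> e00 H.
have lin x a b : at_pair a b (d0 + x *: v) = at_pair a b d0 + x * at_pair a b v :> R.
  by rewrite linearD linearZ.
split=> [i j k l r|i j k l uq n1 n2 n3].
  have [ik il jk jl] := resolved_neq r.
  have [->|ij] := eqVneq i j; first by rewrite addrC.
  have [->|kl] := eqVneq k l; first by [].
  have lt1 := distance_lt r; have eq1 := tangent_distance r.
  apply/eqP; rewrite eq_le; apply/andP; split.
    apply: (@small_max _ _ _ (at_pair i j v + at_pair k l v) _ _ e0 e00 lt1 eq1) => x x0 xe.
    have uq : uniq [:: i; k; j; l] by rewrite /= !inE !negb_or ik ij il kl jl eq_sym jk.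
    have := H x x0 xe _ _ _ _ uq; rewrite !lin !le_max !(at_pairC k j) => /orP[] h; apply/orP; [left|right]; lra.
  have lt2 : at_pair i j d0 + at_pair k l d0 < at_pair i l d0 + at_pair j k d0 :> R by rewrite -eq1.
  apply: (@small_max _ _ _ (at_pair i j v + at_pair k l v) _ _ e0 e00 lt2 (esym eq1)) => x x0 xe.
  have uq : uniq [:: i; l; j; k] by rewrite /= !inE !negb_or il ij ik jk eq_sym jl eq_sym kl.
  have := H x x0 xe _ _ _ _ uq; rewrite !lin !le_max !(at_pairC l j) !(at_pairC l k) => /orP[] h; apply/orP; [left|right]; lra.
have E1 := distance_unresolved_eq n1 n2.
have E2 : at_pair i j d0 + at_pair k l d0 = at_pair i l d0 + at_pair j k d0 :> R.
  have := distance_unresolved_eq (i := i) (j := j) (k := l) (l := k).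
  by rewrite (at_pairC l k); apply=> [/resolved_sym|]; [exact: n1 | exact: n3].
have := H e0 e00 (lexx _) _ _ _ _ uq; rewrite !lin !le_max => /orP[] h; apply/orP; [left|right];
  rewrite -(ler_pM2l e00); lra.
Qed.

Definition local_cone (w : moduli_space R n) :=
  tangent C (vsval w) /\ forall p : C, moduli_support (loc_fun (T := C) p w).

Lemma local_coneP (w : moduli_space R n) :
  local_cone w <-> tangent C (vsval w) /\ local_four_point C (vsval w).
Proof.
split=> -[tw H]; split=> //.
  by apply/local_four_pointP => // p; apply/support_iff; [exact: valence_gt2 | exact: H].
move/local_four_pointP: H => /(_ tw) H p.
by apply/support_iff; [exact: valence_gt2 | exact: H].
Qed.

Lemma support_shift (w : moduli_space R n) x :
  moduli_support (point_of C + x *: w) <-> four_point (d0 + x *: vsval w).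
Proof.
rewrite -support_iff; last exact: leaves_ge3 C.
by rewrite linearD linearZ /= quotv_piK.
Qed.

Lemma local_cone_sufficient w : local_cone w ->
  exists2 e, 0 < e & forall x, 0 <= x -> x <= e -> moduli_support (point_of C + x *: w).
Proof.
move/local_coneP => [tw lw]; have [e e0 eP] := local_cone_open tw lw.
by exists e => // x x0 xe; apply/support_shift; apply: eP.
Qed.

Lemma local_cone_of_segment w e : 0 < e ->
  (forall x, 0 < x -> x <= e -> moduli_support (point_of C + x *: w)) -> local_cone w.
Proof.
move=> e0 H; apply/local_coneP; apply: (@local_cone_necessary _ e) => // x x0 xe.
by apply/support_shift; apply: H.
Qed.

(** The restriction of [w] and its opposite both satisfy the four-point
    condition. *)
Lemma lineality w : local_cone w -> local_cone (- w) -> forall p : C, loc_fun (T := C) p w = 0.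
Proof.
move=> [_ H1] [_ H2] p; have v3 := valence_gt2 p.
have := H2 p; have := H1 p; rewrite linearN /= -{1 2}[loc_fun _ _]quotv_piK -linearN.
rewrite !support_iff // => f1 f2.
by rewrite -[LHS]quotv_piK; apply: four_point_pointed.
Qed.

End LocalCone.

(** * Rational subspaces of the space of edge lengths *)

Section IntegerKernel.
Variable R : realType.
Notation toR := (map_mx (intmul (1 : R))).

(** In the Smith normal form [L * D * P] of [M], let [A] consist of the columns
    of [L] that belong to non-zero diagonal entries of [D].  As [L] is unimodular,
    the corresponding rows of its inverse form a left inverse of [A]: the map [A]
    on integral vectors is onto. *)
Lemma integer_kernel l m (M : 'M[int]_(l, m)) :
  exists r (A : 'M[int]_(l, r)) (B : 'M[int]_(r, l)), B *m A = 1%:M /\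
    forall c : 'rV[R]_l, (c *m toR M == 0) = (c *m toR A == 0).
Proof.
have [L uL [P uP [d _ ME]]] := int_Smith_normal_form M.
pose S := [set i : 'I_l | (i < m)%N && (d`_i != 0)]%SET.
pose A : 'M[int]_(l, #|S|) := \matrix_(i, k) L i (enum_val k).
pose B : 'M[int]_(#|S|, l) := \matrix_(k, i) invmx L (enum_val k) i.
exists #|S|; exists A; exists B; split.
  apply/matrixP => k k'; rewrite !mxE.
  transitivity ((invmx L *m L) (enum_val k) (enum_val k')).
    by rewrite mxE; apply: eq_bigr => i _; rewrite !mxE.
  by rewrite mulVmx // mxE (inj_eq enum_val_inj).
move=> c; set D := \matrix_(i, j) _ in ME; pose y := c *m toR L.
have -> : (c *m toR M == 0) = (y *m toR D == 0).
  rewrite ME !map_mxM !mulmxA -/y; apply/eqP/eqP => [H|->]; last by rewrite mul0mx.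
  have PP : toR P *m toR (invmx P) = 1%:M by rewrite -map_mxM mulmxV // map_mx1.
  by rewrite -[LHS]mulmx1 -PP mulmxA H mul0mx.
have -> : (c *m toR A == 0) = [forall i in S, y 0 i == 0].
  have E k : (c *m toR A) 0 k = y 0 (enum_val k).
    by rewrite !mxE; apply: eq_bigr => i _; rewrite !mxE.
  apply/idP/forall_inP => [/eqP H i iS|H].
    by rewrite -(enum_rankK_in iS iS) -E H [X in X == _]mxE.
  by apply/eqP/rowP => k; rewrite E [RHS]mxE; apply/eqP; apply: H; apply: enum_valP.
apply/idP/forall_inP => [/eqP H i|H].
  rewrite inE => /andP[im di]; have := congr1 (fun z : 'rV_m => z 0 (Ordinal im)) H.
  rewrite !mxE (bigD1 i) //= big1 => [|j ji]; rewrite !mxE /=; last first.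
    by rewrite val_eqE (negbTE ji) mulr0n mulr0z mulr0.
  rewrite eqxx mulr1n addr0 => /eqP; rewrite mulf_eq0 intr_eq0 (negbTE di) orbF.
  by [].
apply/eqP/rowP => j; rewrite mxE [RHS]mxE big1 // => i _.
have -> : toR D i j = (d`_i *+ (i == j :> nat))%:~R by rewrite !mxE.
have [E|_] := eqVneq (i : nat) j; last by rewrite mulr0n mulr0z mulr0.
have [->|di] := eqVneq (d`_i) 0; first by rewrite mul0rn mulr0z mulr0.
have iS : i \in S by rewrite inE di andbT E ltn_ord.
by rewrite (eqP (H i iS)) mul0r.
Qed.

End IntegerKernel.

Section RationalSubspace.
Variables (R : realType) (n : nat) (C : curve R n).
Notation pi := (quotv_pi (limg (Phi R n))).
Notation nedges := #|bounded_edges C|.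
Notation toR := (map_mx (intmul (1 : R))).

Definition coords (w : moduli_space R n) : 'rV[R]_nedges := edge_coord C (vsval w).

Lemma coords_linear : linear coords.
Proof. by move=> c v w; rewrite /coords !linearP. Qed.

HB.instance Definition _ :=
  GRing.isLinear.Build R (moduli_space R n) 'rV[R]_nedges _ coords coords_linear.

Lemma coords_pi v : coords (pi v) = edge_coord C v.
Proof.
have := vsval_quotv_pi (limg (Phi R n)) v; case/Phi_imgP => a /eqP.
by rewrite subr_eq => /eqP E; rewrite /coords E linearD /= edge_coord_Phi add0r.
Qed.

Lemma local_inj w : tangent C (vsval w) -> coords w = 0 ->
  (forall p : C, loc_fun (T := C) p w = 0) -> w = 0.
Proof. by move=> t c l; rewrite -[w]quotv_piK; apply: (local_injective t). Qed.

Definition edge_class e : moduli_space R n := pi (split_vec R (edge_of (T := C) e)).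

Lemma edge_class_expand w : tangent C (vsval w) -> (forall p : C, loc_fun (T := C) p w = 0) ->
  w = \sum_e coords w 0 e *: edge_class e.
Proof.
move=> tw lw; pose s : pair_space R n := \sum_e coords w 0 e *: split_vec R (edge_of (T := C) e).
have sE : \sum_e coords w 0 e *: edge_class e = pi s.
  by rewrite linear_sum; apply: eq_bigr => e _; rewrite linearZ.
apply/eqP; rewrite -subr_eq0 sE; apply/eqP.
have pE : w - pi s = pi (vsval w - s) by rewrite [RHS]linearB /= quotv_piK.
rewrite pE; apply: (local_injective (T := C)).
- apply: tangentD => //; rewrite -scaleN1r; apply: tangentZ; apply: tangent_sum => e _.
  by apply: tangentZ; apply: tangent_split; apply: edge_ofP.
- rewrite linearB /= /s linear_sum /= [X in _ - X](_ : _ = edge_coord C (vsval w)) ?subrr //.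
  rewrite [RHS]row_sum_delta; apply: eq_bigr => e _.
  by rewrite linearZ /= edge_coord_split.
- move=> p; rewrite -loc_pi -pE linearB /= lw sub0r /s linear_sum linear_sum /= big1 ?oppr0 // => e _.
  by rewrite !linearZ /= loc_pi loc_split ?scaler0 //; apply: edge_ofP.
Qed.

Lemma tangent_edge_sum (c : 'rV[R]_nedges) : let w := \sum_e c 0 e *: edge_class e in
  [/\ tangent C (vsval w), forall p : C, loc_fun (T := C) p w = 0 & coords w = c].
Proof.
pose s : pair_space R n := \sum_e c 0 e *: split_vec R (edge_of (T := C) e).
have sE : \sum_e c 0 e *: edge_class e = pi s.
  by rewrite linear_sum; apply: eq_bigr => e _; rewrite linearZ.
rewrite /= sE; split.
- apply: (@tangent_pi _ _ _ s); first by rewrite quotv_piK.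
  by apply: tangent_sum => e _; apply: tangentZ; apply: tangent_split; apply: edge_ofP.
- move=> p; rewrite loc_pi /s !linear_sum /= ?linear_sum big1 // => e _.
  by rewrite !linearZ /= loc_split ?scaler0 //; apply: edge_ofP.
- rewrite coords_pi /s linear_sum [RHS]row_sum_delta; apply: eq_bigr => e _.
  by rewrite linearZ /= edge_coord_split.
Qed.

(** On the space of edge lengths, the functionals in [s] have integral
    coefficients, because the split vectors belong to the lattice.  The number
    of columns of [A] is the codimension of [D] there, as [A] is surjective with
    kernel [D]. *)
Lemma rational_coords (D : {vspace moduli_space R n}) (s : seq 'Hom(moduli_space R n, R^o)) :
  (forall w, w \in D -> tangent C (vsval w) /\ forall p : C, loc_fun (T := C) p w = 0) ->
  (forall f, f \in s -> forall v, moduli_lattice v -> (f v : R) \is a Num.int) ->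
  (forall w, w \in D <-> forall f, f \in s -> f w = 0) ->
  exists (A : 'M[int]_(nedges, nedges - \dim D)) (B : 'M[int]_(nedges - \dim D, nedges)),
    B *m A = 1%:M /\
    forall w, tangent C (vsval w) -> (forall p : C, loc_fun (T := C) p w = 0) ->
      (w \in D) = (coords w *m toR A == 0).
Proof.
move=> DW sint sD.
pose M : 'M[int]_(nedges, size s) := \matrix_(e, k) Num.floor ((s`_k : 'Hom(_, _)) (edge_class e) : R).
have latt e : moduli_lattice (edge_class e).
  by apply: even_lattice; [exact: leaves_ge3 C | apply: split_even; apply: edge_ofP].
have ME w k : tangent C (vsval w) -> (forall p : C, loc_fun (T := C) p w = 0) ->
    (coords w *m toR M) 0 k = s`_k w.
  move=> tw lw; rewrite [in RHS](edge_class_expand tw lw) linear_sum mxE; apply: eq_bigr => e _.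
  rewrite linearZ !mxE /=; congr (_ * _); apply/eqP; rewrite -intrEfloor.
  by apply: sint => //; apply: mem_nth.
have [r [A [B [BA AP]]]] := integer_kernel R M.
have DA w : tangent C (vsval w) -> (forall p : C, loc_fun (T := C) p w = 0) ->
      (w \in D) = (coords w *m toR A == 0).
  move=> tw lw; rewrite -AP; apply/idP/eqP => [/sD H|H].
    by apply/rowP => k; rewrite ME // mxE H // mem_nth.
  by apply/sD => f /(nthP 0)[k ks <-]; rewrite -(ME w (Ordinal ks)) // H mxE.
suff E : (nedges - \dim D = r)%N by rewrite E; exists A; exists B.
pose hA : 'Hom('rV[R]_nedges, 'rV[R]_r) := linfun (mulmxr (toR A)).
pose hc : 'Hom(moduli_space R n, 'rV[R]_nedges) := linfun coords.
have BAR : toR B *m toR A = 1%:M by rewrite -map_mxM BA map_mx1.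
have img : limg hA = fullv.
  apply/vspaceP => y; rewrite memvf; apply/memv_imgP; exists (y *m toR B); first exact: memvf.
  by rewrite lfunE /= -mulmxA BAR mulmx1.
have dimD : \dim D = \dim (lker hA).
  rewrite -(@limg_dim_eq _ _ _ hc D).
    congr (\dim _); apply/vspaceP => c; apply/memv_imgP/idP => [[w wD ->]|].
      rewrite memv_ker !lfunE /=; have [tw lw] := DW w wD; by rewrite -DA.
    rewrite memv_ker lfunE /= => cA; have [tw lw cw] := tangent_edge_sum c.
    by exists (\sum_e c 0 e *: edge_class e); [rewrite DA // cw | rewrite lfunE /= cw].
  apply/eqP; rewrite -subv0; apply/subvP => w; rewrite memv_cap memv_ker lfunE /= memv0.
  by move=> /andP[wD /eqP cw]; have [tw lw] := DW w wD; apply/eqP; apply: local_inj.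
have := limg_ker_dim hA fullv; rewrite capfv img !dimvf -dimD /dim /=.
rewrite !mul1n => <-; by rewrite addKn.
Qed.

End RationalSubspace.

(** * The star of a cell *)

Local Open Scope classical_set_scope.

Section StarGeometry.
Variables (R : realType) (V : vectType R) (Lambda : set V).
Variables (M : weighted_complex V) (tau : set V) (x0 : V).
Hypothesis complexM : polyhedral_complex Lambda M.
Hypothesis cell_tau : cells M tau.
Hypothesis relint_x0 : relint tau x0.

Definition tangent_direction (v : V) :=
  exists2 e, 0 < e & forall x, 0 <= x -> x <= e -> Defs.support M (x0 + x *: v).

Lemma tau_x0 : tau x0. Proof. by case: relint_x0. Qed.

Lemma directionP a b (sigma : set V) : sigma a -> sigma b -> a - b \in direction sigma.
Proof.
move=> sa sb; have [H _] := span_setP [set v | exists a b, sigma a /\ sigma b /\ v = a - b].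
by apply: H; exists a; exists b.
Qed.

Lemma direction_small v : v \in direction tau ->
  exists2 e, 0 < e & forall x, `|x| <= e -> tau (x0 + x *: v).
Proof.
case: relint_x0 => _ [e e0 H] vd.
pose K := 1 + \sum_j `|coord (vbasis {:V}) j v|.
have K0 : 0 < K by rewrite ltr_pwDl // sumr_ge0.
exists (e / K); first by rewrite divr_gt0.
move=> x xe; apply: H; first exact: memvZ.
move=> j; rewrite linearZ /= normrM.
have jK : `|coord (vbasis {:V}) j v| < K.
  rewrite /K (bigD1 j) //= addrCA ltrDl ltr_pwDl // sumr_ge0 //.
have [->|x1] := eqVneq x 0; first by rewrite normr0 mul0r.
apply: (@lt_le_trans _ _ (`|x| * K)); first by rewrite ltr_pM2l // normr_gt0.
by rewrite -ler_pdivlMr.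
Qed.

Lemma polyhedron_segment (sigma : set V) x v e : rational_polyhedron Lambda sigma ->
  0 < e -> sigma x -> sigma (x + e *: v) ->
  forall t, 0 <= t -> t <= e -> sigma (x + t *: v).
Proof.
case=> _ [s [_ ->]] e0 /= sx se t t0 te fa fs.
have := sx _ fs; have := se _ fs; rewrite !linearD !linearZ /= /GRing.scale /= => h1 h2.
have [h|h] := leP 0 (fa.1 v : R).
  by have := mulr_ge0 t0 h; lra.
have : e * fa.1 v <= t * fa.1 v :> R by rewrite ler_nM2r.
by lra.
Qed.

(** Points of the polyhedron arbitrarily close to [x0] on a ray suffice. *)
Lemma polyhedron_closed (sigma : set V) v : rational_polyhedron Lambda sigma ->
  (forall e, 0 < e -> exists2 x, 0 < x <= e & sigma (x0 + x *: v)) -> sigma x0.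
Proof.
case=> _ [s [_ ->]] H fa fs; rewrite leNgt; apply/negP => lt.
have [e e0 eP] := small_lt (fa.1 v : R) (- 1) lt.
have [x /andP[x_gt0 xe] /= /(_ _ fs)] := H e e0.
rewrite linearD linearZ /= /GRing.scale /=.
by have := eP x (ltW x_gt0) xe; lra.
Qed.

Lemma cells_seq : exists s : seq (set V), forall sigma, cells M sigma <-> sigma \in s.
Proof.
case: complexM => /finite_seqP[s sE] _ _ _; exists s => sigma.
by rewrite sE.
Qed.

(** There are finitely many cells, so one of them contains points arbitrarily
    close to [x0] on the ray. *)
Lemma cell_through v : tangent_direction v -> exists sigma e,
  [/\ cells M sigma, sigma x0, 0 < e & sigma (x0 + e *: v)].
Proof.
case=> e e0 H; have [s sP] := cells_seq; case: (complexM) => _ rat _ _.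
apply: contrapT => no.
have [|d d0 dP] := @small_seq R _ s (fun sigma x => 0 < x -> ~ sigma (x0 + x *: v)).
  move=> sigma /sP Ms; apply: contrapT => H'.
  have freq c : 0 < c -> exists2 x, 0 < x <= c & sigma (x0 + x *: v).
    move=> c0; apply: contrapT => H2; apply: H'; exists c => // x _ xc x_gt0 sx.
    by apply: H2; exists x => //; rewrite x_gt0.
  have [x /andP[x_gt0 _] sx] := freq 1 ltr01.
  by apply: no; exists sigma; exists x; split=> //; apply: polyhedron_closed freq; apply: rat.
have m0 : 0 < Num.min e d by rewrite lt_min e0.
have [|sigma Ms] := H _ (ltW m0); first by rewrite ge_min lexx.
by apply: (dP sigma); [exact/sP | exact: ltW | rewrite ge_min lexx orbT | ].
Qed.

(** A functional that attains its minimum at a relative interior point is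
    constant. *)
Lemma face_full (rho : set V) : face rho tau -> rho x0 -> rho = tau.
Proof.
case=> _ [f [a [fa ->]]] [_ /= fx0]; apply/seteqP; split=> [x []//|x tx]; split=> //=.
have [e e0 eP] := direction_small (directionP tau_x0 tx).
apply/eqP; rewrite eq_le fa // andbT.
have := fa _ (eP e _); rewrite gtr0_norm // lexx => /(_ isT).
rewrite linearD linearZ linearB /= fx0 /GRing.scale /= => h.
have : 0 <= e * (a - f x) :> R by lra.
by rewrite pmulr_rge0 // subr_ge0.
Qed.

Lemma cell_face sigma : cells M sigma -> sigma x0 -> face tau sigma.
Proof.
move=> Ms sx; case: complexM => _ _ _ meet.
have [|f1 f2] := meet sigma tau Ms cell_tau; first by exists x0; split=> //; apply: tau_x0.
by rewrite (face_full f2) in f1 => //; split=> //; apply: tau_x0.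
Qed.

Lemma face_subset (rho sigma : set V) : face rho sigma -> rho `<=` sigma.
Proof. by case=> _ [f [a [_ ->]]] x []. Qed.

Lemma convex_step (a b x : V) e : 0 < e ->
  x + (e / (1 + e)) *: (a - b) = a + (1 / (1 + e)) *: ((x + e *: (x - b)) - a).
Proof.
move=> e0; have e1 : 1 + e != 0 by apply: lt0r_neq0; rewrite addr_gt0.
set q := e / (1 + e).
have -> : (x + e *: (x - b)) - a = (x - a) + e *: (x - b) by rewrite addrAC.
rewrite [in RHS]scalerDr scalerA.
have -> : 1 / (1 + e) * e = q by rewrite /q; field.
have -> : 1 / (1 + e) = 1 - q by rewrite /q; field.
rewrite scalerBl scale1r !scalerBr; move: (q *: a) (q *: b) (q *: x) => u w z.
have -> : a + (x - a - (z - u) + (z - w)) = x - (z - u) + (z - w).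
  by rewrite !addrA [a + x]addrC addrK.
by rewrite opprB -[in RHS]addrA [u - z + _]addrA subrK.
Qed.

(** For a cell [sigma] containing [tau] and points [a] of [sigma] and [b] of
    [tau], the direction [a - b] stays in [sigma] for a while when started at
    [x0], although [x0] is in general not [b]: first go from [b] through [x0] to
    a point of [tau] beyond it, then towards [a]. *)
Lemma star_support :
  Defs.support (Star Lambda M tau) = quotv_pi (direction tau) @` tangent_direction.
Proof.
case: (complexM) => _ rat _ _; apply/seteqP; split=> [w|_ [v tv <-]].
  case=> kappa [[sigma [Ms fs _ ->]]|->]; last first.
    move=> ->; exists 0; last by rewrite linear0.
    by exists 1 => // x _ _; rewrite scaler0 addr0; exists tau => //; apply: tau_x0.
  case=> c [a [b [c0 sa tb ->]]]; exists (c *: (a - b)); last by rewrite linearZ.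
  have sx0 : sigma x0 by apply: (face_subset fs); apply: tau_x0.
  have [e e0 eP] := direction_small (directionP tau_x0 tb).
  (* The segment ends on the one from [a] to a point of [tau] beyond [x0]. *)
  have sy : sigma (x0 + (e / (1 + e)) *: (a - b)).
    have sy : sigma (x0 + e *: (x0 - b)) by apply: (face_subset fs); apply: eP; rewrite gtr0_norm.
    rewrite convex_step //.
    apply: (@polyhedron_segment sigma a _ 1) => //; first exact: rat.
      by rewrite scale1r addrC subrK.
      by rewrite divr_ge0 // addr_ge0 // ltW.
    by rewrite ler_pdivrMr ?addr_gt0 // mul1r lerDl ltW.
  have [->|cn] := eqVneq c 0.
    by exists 1 => // x _ _; rewrite scale0r scaler0 addr0; exists sigma.
  have cp : 0 < c by rewrite lt_def cn.
  exists (e / (1 + e) / c); first by rewrite !divr_gt0 // addr_gt0.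
  move=> x x_ge0 xe; exists sigma => //; rewrite scalerA.
  apply: (@polyhedron_segment sigma x0 _ (e / (1 + e))) => //; first exact: rat.
  - by rewrite divr_gt0 // addr_gt0.
  - by rewrite mulr_ge0.
  - by rewrite -ler_pdivlMr.
have [sigma [e [Ms sx e0 se]]] := cell_through tv.
have [ts|ts] := pselect (tau = sigma).
  exists [set 0]; first by right.
  rewrite /=; apply/eqP; rewrite quotv_pi0.
  have : x0 + e *: v - x0 \in direction tau by apply: directionP; rewrite ?ts // -ts; apply: tau_x0.
  by rewrite addrC addKr rpredZeq gt_eqF.
exists (@star_cone R V tau sigma); first by left; exists sigma; split=> //; apply: cell_face.
exists e^-1; exists (x0 + e *: v); exists x0; split=> //; first by rewrite invr_ge0 ltW.
  exact: tau_x0.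
by rewrite [x0 + _]addrC addrK linearZ /= scalerA mulVf ?gt_eqF // scale1r.
Qed.

Lemma maximal_above sigma : cells M sigma -> exists2 rho, maximal_cell M rho & sigma `<=` rho.
Proof.
have [s sP] := cells_seq.
suff gen (t : seq (set V)) : forall sigma, sigma \in t -> exists rho,
    [/\ rho \in t, sigma `<=` rho & forall rho', rho' \in t -> rho `<=` rho' -> rho' = rho].
  move=> /sP /gen[rho [rs sr max]]; exists rho => //; split; first exact/sP.
  by move=> rho' /sP; apply: max.
elim: t => // a t IH {}sigma.
have step rho : rho \in t -> sigma `<=` rho ->
    (forall rho', rho' \in t -> rho `<=` rho' -> rho' = rho) -> exists rho,
    [/\ rho \in a :: t, sigma `<=` rho & forall rho', rho' \in a :: t -> rho `<=` rho' -> rho' = rho].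
  move=> rt sr max; have [ra|nra] := pselect (rho `<=` a).
    exists a; split; [exact: mem_head | exact: subset_trans ra |].
    move=> rho'; rewrite inE => /orP[/eqP ->//|rt'] ar'.
    have E := max _ rt' (subset_trans ra ar').
    by apply/seteqP; split=> //; rewrite E.
  exists rho; split=> //; first by rewrite inE rt orbT.
  by move=> rho'; rewrite inE => /orP[/eqP ->//|]; apply: max.
rewrite inE => /orP[/eqP E|/IH[rho [rt sr max]]]; last exact: step max.
have [[b bt ab]|no] := pselect (exists2 b, b \in t & a `<=` b).
  have [rho [rt br max]] := IH b bt.
  by apply: (step rho) => //; rewrite E; apply: subset_trans ab br.
exists a; rewrite E; split=> //; first exact: mem_head.
move=> rho'; rewrite inE => /orP[/eqP //|rt ar]; exfalso; apply: no.
by exists rho'.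
Qed.

Lemma face_of_superset sigma : cells M sigma -> tau `<=` sigma -> face tau sigma.
Proof. by move=> Ms ts; apply: cell_face => //; apply: ts; apply: tau_x0. Qed.

(** A maximal cone of the star is the cone of some maximal cell, because passing
    to a larger cell enlarges the cone; the cone [0] comes from [tau] itself if
    [tau] is maximal. *)
Lemma star_weight (m : int) kappa :
  (forall sigma, maximal_cell M sigma -> weight M sigma = m) ->
  maximal_cell (Star Lambda M tau) kappa -> weight (Star Lambda M tau) kappa = m.
Proof.
move=> wM [Xk maxk]; rewrite /=; set P := [set sigma | _].
suff [sigma Ps] : P !=set0.
  by have [mP _ _] := @xgetPex _ tau P (ex_intro _ sigma Ps); apply: wM.
case: Xk => [[sigma [Ms fs ts kE]]|kE].
  have [rho mrho sr] := maximal_above Ms; have trho := subset_trans (face_subset fs) sr.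
  have frho : face tau rho by apply: face_of_superset => //; case: mrho.
  exists rho; split=> //; symmetry; apply: maxk.
    left; exists rho; split=> //; first by case: mrho.
    move=> E; apply: ts; apply/seteqP; split; first exact: face_subset.
    by rewrite E.
  rewrite kE => w [c [a [b [c0 sa tb ->]]]]; exists c; exists a; exists b; split=> //.
  exact: sr.
have [rho mrho tr] := maximal_above cell_tau.
have frho : face tau rho by apply: face_of_superset => //; case: mrho.
exists rho; split=> //; have [E|ne] := pselect (tau = rho).
  rewrite kE -E; apply/seteqP; split=> [w ->|w [c [a [b [_ ta tb ->]]]]].
    exists 0; exists x0; exists x0; split=> //; try exact: tau_x0.
    by rewrite scale0r.
  suff /eqP -> : quotv_pi (direction tau) (a - b) == 0 by rewrite /= scaler0.
  by rewrite quotv_pi0; apply: directionP.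
symmetry; apply: maxk.
  by left; exists rho; split=> //; case: mrho.
rewrite kE => w ->; exists 0; exists x0; exists x0; split=> //; try exact: tau_x0.
  by apply: tr; apply: tau_x0.
by rewrite scale0r.
Qed.

(** The functionals of the inequalities that are tight at the relative interior
    point cut out the directions of [tau]. *)
Lemma direction_rational : exists s : seq 'Hom(V, R^o),
  (forall f, f \in s -> forall v, Lambda v -> (f v : R) \is a Num.int) /\
  forall v, v \in direction tau <-> forall f, f \in s -> f v = 0.
Proof.
case: (complexM) => _ /(_ _ cell_tau)[_ [s [sint tE]]] _ _.
exists [seq fa.1 | fa : 'Hom(V, R^o) * R <- s & (fa.1 x0 : R) == fa.2]; split.
  by move=> f /mapP[fa]; rewrite mem_filter => /andP[_ fs] ->; apply: sint.
have tau0 : forall fa, fa \in s -> fa.2 <= fa.1 x0 :> R by have := tau_x0; rewrite tE.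
move=> v; split=> [vd f /mapP[fa]|H].
  rewrite mem_filter => /andP[/eqP E fs] ->.
  have [e e0 eP] := direction_small vd.
  have := eP e; rewrite {1}tE gtr0_norm // lexx => /(_ isT) /(_ _ fs).
  have := eP (- e); rewrite {1}tE normrN gtr0_norm // lexx => /(_ isT) /(_ _ fs).
  rewrite !linearD !linearZ /= E /GRing.scale /= => h1 h2.
  have : e * fa.1 v = 0 :> R by lra.
  by move=> /eqP; rewrite mulf_eq0 gt_eqF //= => /eqP.
have [|e e0 eP] := @small_seq R _ s (fun fa x => fa.2 <= fa.1 (x0 + x *: v) :> R).
  move=> fa fs; have [E|ne] := eqVneq (fa.1 x0 : R) fa.2.
    exists 1 => // x _ _; rewrite linearD linearZ /= H ?scaler0 ?addr0 ?E //.
    by apply: map_f; rewrite mem_filter E eqxx.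
  have lt : fa.2 < fa.1 x0 :> R by rewrite lt_def ne tau0.
  have [d d0 dP] := small_lt 0 (fa.1 v : R) lt; exists d => // x x_ge0 xd.
  by have := dP x x_ge0 xd; rewrite mulr0 addr0 linearD linearZ.
have te : tau (x0 + e *: v) by rewrite tE => fa fs /=; apply: eP => //; exact: ltW.
have := directionP te tau_x0; by rewrite addrC addKr rpredZeq gt_eqF.
Qed.

End StarGeometry.

(** * The isomorphism *)

Section PairMap.
Variables (R : fieldType) (U V W : vectType R) (f : 'Hom(U, V)) (g : 'Hom(U, W)).

Definition pair_map (u : U) : V * W := (f u, g u).

Lemma pair_map_linear : linear pair_map.
Proof. by move=> c x y; rewrite /pair_map !linearP. Qed.

HB.instance Definition _ := GRing.isLinear.Build R U (V * W)%type _ pair_map pair_map_linear.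

End PairMap.

Section Fans.
Variable R : realType.

Lemma support_fan_prod (X Y : fan R) a b :
  Defs.support (fan_prod X Y) (a, b) <-> Defs.support X a /\ Defs.support Y b.
Proof.
split=> [[kappa [s [r [Xs Yr ->]]] [sa rb]]|[[s Xs sa] [r Yr rb]]].
  by split; [exists s | exists r].
by exists (s `*` r) => //; exists s; exists r.
Qed.

End Fans.

Section Realization.
Variables (R : realType) (n : nat) (C : curve R n) (r : nat).
Variables (A : 'M[int]_(#|bounded_edges C|, r)) (B : 'M[int]_(r, #|bounded_edges C|)).
Hypothesis BA : B *m A = 1%:M.
Notation toR := (map_mx (intmul (1 : R))).
Notation loc p w := (loc_fun (T := C) p w).
Implicit Types (w : moduli_space R n) (p : C) (ps : seq C).

Definition line_part w : 'rV[R]_r := coords C w *m toR A.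

Lemma line_part_linear : linear line_part.
Proof. by move=> c v w; rewrite /line_part linearP /= mulmxDl scalemxAl. Qed.

HB.instance Definition _ :=
  GRing.isLinear.Build R (moduli_space R n) 'rV[R]_r _ line_part line_part_linear.

(** [F] identifies the product [Y] of a vector space and the moduli spaces of
    the vertices in [ps] with the line part and the restrictions at [ps].  The
    fourth clause recovers independent components from a point of [Y]; it
    expresses surjectivity in a form that is inherited by products. *)
Definition realizes ps (Y : fan R) (F : 'Hom(moduli_space R n, ambient Y)) := [/\
  forall w, F w = 0 <-> line_part w = 0 /\ forall p, p \in ps -> loc p w = 0,
  forall w, lattice Y (F w) <->
    (forall j, line_part w 0 j \is a Num.int) /\ forall p, p \in ps -> moduli_lattice (loc p w),
  forall w, Defs.support Y (F w) <-> forall p, p \in ps -> moduli_support (loc p w),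
  forall y, exists x (u : forall p, moduli_space R (valence p)), forall w,
    line_part w = x -> (forall p, p \in ps -> loc p w = u p) -> F w = y
  & forall kappa, weight Y kappa = 1].

Lemma realizes_nil : realizes [::] (Y := affine_space R r) (linfun line_part).
Proof.
split=> [w|w|w|y|//]; rewrite ?lfunE /=.
- by split=> [->|[]].
- by split=> [H|[]].
- by split=> // _; exists setT.
- exists y; exists (fun=> 0) => w; rewrite lfunE /=; by move=> ->.
Qed.

Lemma realizes_cons ps p Y F : p \notin ps -> realizes ps (Y := Y) F ->
  realizes (p :: ps) (Y := fan_prod Y (moduli R (valence p)))
    (linfun (pair_map F (linfun (loc_fun (T := C) p)))).
Proof.
move=> nps [F0 Flat Fsupp Fsurj Fw].
have FE w : linfun (pair_map F (linfun (loc_fun (T := C) p))) w = (F w, loc p w).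
  by rewrite lfunE /= /pair_map lfunE.
have all_cons (Q : C -> Prop) : (forall q, q \in p :: ps -> Q q) <-> Q p /\ forall q, q \in ps -> Q q.
  split=> [H|[Hp H] q]; last by rewrite inE => /orP[/eqP ->|/H].
  by split=> [|q qs]; apply: H; rewrite inE ?eqxx ?qs ?orbT.
split=> [w|w|w|[y1 y2]|kappa].
- rewrite FE (all_cons (fun q => loc q w = 0)); split.
    by case=> /F0[-> ?] ->.
  by case=> l0 [lp H]; congr pair => //; apply/F0.
- rewrite FE (all_cons (fun q => moduli_lattice (loc q w))); split.
    by case=> /= /Flat[].
  by case=> l0 [lp H]; split=> //=; apply/Flat.
- rewrite FE support_fan_prod support_moduli Fsupp.
  by rewrite (all_cons (fun q => moduli_support (loc q w))); split=> -[].
- have [x [u xu]] := Fsurj y1; exists x.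
  exists (dfwith u (i := p) y2) => w lw; rewrite (all_cons (fun q => loc q w = dfwith u y2 q)).
  rewrite dfwith_in => -[lp H]; rewrite FE lp; congr pair; apply: xu => // q qs.
  by rewrite H // dfwith_out //; apply: contraNneq nps => ->.
- by rewrite /= Fw.
Qed.

Lemma realizes_foldl qs ps Y F : uniq (qs ++ ps) -> realizes ps (Y := Y) F ->
  exists F', realizes (rev qs ++ ps)
    (Y := foldl (fun X p => fan_prod X (moduli R (valence p))) Y qs) F'.
Proof.
elim: qs ps Y F => [|q qs IH] ps Y F; first by exists F.
rewrite cat_cons cons_uniq => /andP[nq uq] rF.
have nqps : q \notin ps by move: nq; rewrite mem_cat negb_or => /andP[].
have [|F' rF'] := IH (q :: ps) _ _ _ (realizes_cons nqps rF).
  rewrite -cat_rcons cat_uniq rcons_uniq; move: uq nq; rewrite cat_uniq mem_cat negb_or.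
  move=> /and3P[u1 u2 u3] /andP[nq1 nq2]; rewrite u1 u3 nq1 /= andbT.
  apply/hasPn => z zp; rewrite mem_rcons inE negb_or; apply/andP; split.
    by apply: contraNneq nq2 => <-.
  by move/hasPn: u2 => /(_ z zp).
by exists F'; rewrite rev_cons cat_rcons.
Qed.

Lemma line_part_int w : moduli_lattice w -> forall j, line_part w 0 j \is a Num.int.
Proof.
move=> /lattice_even[v ev ->] j; rewrite /line_part coords_pi mxE rpred_sum // => e _.
by rewrite rpredM // ?edge_coord_even // mxE intr_int.
Qed.

Lemma loc_lattice p w : moduli_lattice w -> moduli_lattice (loc p w).
Proof.
move=> /lattice_even[v ev ->]; rewrite loc_pi; apply: even_lattice; first exact: valence_gt2.
by exists (restr p v) => //; apply: even_restr.
Qed.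

Lemma section_line (x : 'rV[R]_r) : (x *m toR B) *m toR A = x.
Proof. by rewrite -mulmxA -map_mxM BA map_mx1 mulmx1. Qed.

Lemma lift_exists (x : 'rV[R]_r) (u : forall p, moduli_space R (valence p)) :
  exists w, [/\ tangent C (vsval w), line_part w = x & forall p, loc p w = u p].
Proof.
have [v [tv cv lv _]] := local_lift (T := C) (x *m toR B) (fun p => vsval (u p)).
exists (quotv_pi (limg (Phi R n)) v); split.
- by apply: (tangent_pi _ tv); rewrite quotv_piK.
- by rewrite /line_part coords_pi cv section_line.
- by move=> p; rewrite loc_pi lv quotv_piK.
Qed.

Lemma lift_lattice (x : 'rV[R]_r) (u : forall p, moduli_space R (valence p)) :
  (forall j, x 0 j \is a Num.int) -> (forall p, moduli_lattice (u p)) ->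
  exists w, [/\ tangent C (vsval w), line_part w = x, forall p, loc p w = u p & moduli_lattice w].
Proof.
move=> ix lu; have evu p : exists2 v, even_vec v & u p = quotv_pi (limg (Phi R (valence p))) v.
  exact: lattice_even (lu p).
pose u' p := s2val (cid2 (evu p)).
have [v [tv cv lv ev]] := local_lift (T := C) (x *m toR B) u'.
exists (quotv_pi (limg (Phi R n)) v); split.
- by apply: (tangent_pi _ tv); rewrite quotv_piK.
- by rewrite /line_part coords_pi cv section_line.
- by move=> p; rewrite loc_pi lv -(s2valP' (cid2 (evu p))).
- apply: even_lattice; first exact: leaves_ge3 C.
  apply: ev => [p|e]; first exact: (s2valP (cid2 (evu p))).
  by rewrite mxE rpred_sum // => j _; rewrite rpredM // mxE intr_int.
Qed.

End Realization.

Lemma tangent_vspace (R : realType) n (T : combinatorial_type n) :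
  exists N : {vspace moduli_space R n}, forall w, w \in N <-> tangent T (vsval w).
Proof.
pose I : finType := ('I_n * 'I_n * ('I_n * 'I_n))%type.
pose phi (q : I) (w : moduli_space R n) : R^o :=
  at_pair q.1.1 q.2.1 (vsval w) + at_pair q.1.2 q.2.2 (vsval w)
  - (at_pair q.1.1 q.2.2 (vsval w) + at_pair q.1.2 q.2.1 (vsval w)).
have phi_linear q : linear (phi q).
  by move=> c v w; rewrite /phi !linearP /= /GRing.scale /=; ring.
pose hphi q := linfun (HB.pack_for {linear moduli_space R n -> R^o} (phi q)
   (GRing.isLinear.Build R (moduli_space R n) R^o _ (phi q) (phi_linear q))).
pose P (q : I) := `[< resolved T q.1.1 q.1.2 q.2.1 q.2.2 >].
exists (\bigcap_(q | P q) lker (hphi q))%VS => w.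
rewrite memvE; split=> [/subv_bigcapP H i j k l r|tw].
  have /H : P ((i, j), (k, l)) by apply/asboolP.
  by rewrite -memvE memv_ker lfunE /= subr_eq0 => /eqP.
apply/subv_bigcapP => -[[i j] [k l]] /asboolP r; rewrite -memvE memv_ker lfunE /=.
by rewrite subr_eq0; apply/eqP; apply: tw.
Qed.

Theorem corollary6p18 (R : realType) (n : nat)
    (M : weighted_complex (moduli_space R n)) (tau : set (moduli_space R n))
    (d : nat) (C : curve R n) :
  moduli_structure M ->
  cells M tau ->
  dimension tau = d ->
  relint tau (point_of C) ->
  fan_iso (Star (@moduli_lattice R n) M tau)
    (foldl (fun X p => fan_prod X (moduli R (valence p)))
       (affine_space R (#|bounded_edges C| - d))
       (enum (curve_type C))).
Proof.
move=> [cM sM wM] Mtau <- rx; set D := direction tau.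
have coneP w : tangent_direction M (point_of C) w <-> local_cone C w.
  rewrite /tangent_direction sM; split=> [[e e0 H]|]; last exact: local_cone_sufficient.
  by apply: (local_cone_of_segment e0) => x x0; apply: H; apply: ltW.
(* A direction of [tau] and its opposite both lie in the local cone. *)
have lin w : w \in D -> local_cone C w.
  move=> /(direction_small rx)[e e0 H]; apply/coneP; exists e => // x x_ge0 xe.
  by exists tau => //; apply: H; rewrite ger0_norm.
have DW w : w \in D -> tangent C (vsval w) /\ forall p : C, loc_fun (T := C) p w = 0.
  move=> wD; have c1 := lin w wD; split; first by case: c1.
  by apply: lineality => //; apply: lin; rewrite memvN.
have [s [sint sD]] := direction_rational cM Mtau rx.
have [A [B [BA AP]]] := rational_coords DW sint sD.
have uenum : uniq (enum C ++ [::]) by rewrite cats0 enum_uniq.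
have [F [F0 Flat Fsupp Fsurj Fw]] := realizes_foldl uenum (realizes_nil A).
set Y := foldl _ _ _ in F F0 Flat Fsupp Fsurj Fw *.
have allv (Q : C -> Prop) : (forall p, p \in rev (enum C) ++ [::] -> Q p) <-> forall p, Q p.
  by split=> H p; [apply: H; rewrite cats0 mem_rev mem_enum | move=> _; apply: H].
have {}F0 w : F w = 0 <-> line_part A w = 0 /\ forall p : C, loc_fun (T := C) p w = 0.
  by rewrite F0 (allv (fun p => _ = _)).
have {}Flat w : lattice Y (F w) <-> (forall j, line_part A w 0 j \is a Num.int) /\
    forall p : C, moduli_lattice (loc_fun (T := C) p w).
  by rewrite Flat (allv (fun p => moduli_lattice _)).
have {}Fsupp w : Defs.support Y (F w) <-> forall p : C, moduli_support (loc_fun (T := C) p w).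
  by rewrite Fsupp (allv (fun p => moduli_support _)).
have {}Fsurj y : exists x (u : forall p : C, moduli_space R (valence p)), forall w,
    line_part A w = x -> (forall p : C, loc_fun (T := C) p w = u p) -> F w = y.
  by have [x [u H]] := Fsurj y; exists x; exists u => w lw lu; apply: H.
pose pi := quotv_pi D.
have FD w : w \in D -> F w = 0.
  by move=> wD; have [tw lw] := DW w wD; apply/F0; split=> //; apply/eqP; rewrite -AP.
(* So [F] is injective on the tangent vectors modulo [D], and they contain the
   local cone. *)
have inj w : tangent C (vsval w) -> F w = 0 -> pi w = 0.
  by move=> tw /F0[/eqP lw H]; apply/eqP; rewrite quotv_pi0 AP.
have gl : linear (fun z : quotv D => F (vsval z)) by move=> c x y; rewrite !linearP.
pose g : 'Hom(quotv D, ambient Y) :=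
  linfun (HB.pack_for {linear quotv D -> ambient Y} (fun z : quotv D => F (vsval z))
    (GRing.isLinear.Build R (quotv D) (ambient Y) _ (fun z : quotv D => F (vsval z)) gl)).
have gpi w : g (pi w) = F w.
  rewrite lfunE /=; apply/eqP; rewrite -subr_eq0 -linearB; apply/eqP/FD.
  exact: vsval_quotv_pi.
set X := Star _ _ _.
have suppX : Defs.support X = pi @` local_cone C.
  rewrite /X (star_support cM Mtau rx); apply/seteqP; split=> [_ [w tw <-]|_ [w tw <-]];
    by exists w => //; apply/coneP.
have suppg : g @` Defs.support X = Defs.support Y.
  rewrite suppX; apply/seteqP; split=> [_ [_ [w [tw sw] <-] <-]|y sy].
    by rewrite gpi; apply/Fsupp.
  have [x [u xu]] := Fsurj y; have [w [tw lw lu]] := lift_exists BA x u.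
  have Fwy : F w = y by apply: xu.
  exists (pi w); last by rewrite gpi.
  by exists w => //; split=> //; apply/Fsupp; rewrite Fwy.
have [spanX minX] := span_setP (Defs.support X).
have [spanY minY] := span_setP (Defs.support Y).
have [N NP] := tangent_vspace R C.
have SN z : z \in span_set (Defs.support X) -> exists2 w, tangent C (vsval w) & z = pi w.
  move=> zS; have /subvP/(_ z zS)/memv_imgP[w wN ->] : (span_set (Defs.support X) <= pi @: N)%VS.
    by apply: minX => a; rewrite suppX => -[w [tw _] <-]; apply: memv_img; apply/NP.
  by exists w => //; apply/NP.
have img : (g @: span_set (Defs.support X) = span_set (Defs.support Y))%VS.
  apply: subv_anti; apply/andP; split.
    apply/subvP => y /memv_imgP[z zS ->].
    suff /subvP/(_ z zS) : (span_set (Defs.support X) <= g @^-1: span_set (Defs.support Y))%VS.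
      by rewrite -memv_preim.
    apply: minX => a Xa; rewrite -memv_preim; apply: spanY; rewrite -suppg; by exists a.
  apply: minY => y; rewrite -suppg => -[z Xz <-]; apply: memv_img; exact: spanX.
exists g; split=> //.
- apply/eqP; rewrite -subv0; apply/subvP => z; rewrite memv_cap memv_ker memv0 => /andP[/eqP gz /SN[w tw zE]].
  by apply/eqP; rewrite zE; apply: inj => //; rewrite -gpi -zE.
- apply/seteqP; split=> [_ [z [[w Lw wz] zS] <-]|y [Ly yS]].
    split; last by rewrite /= -img; apply: memv_img.
    rewrite -wz gpi; apply/Flat; split; first exact: line_part_int.
    by move=> p; apply: loc_lattice.
  have [x [u xu]] := Fsurj y; have [w [tw lw lu]] := lift_exists BA x u.
  have Fwy : F w = y by apply: xu.
  have [ix iu] : (forall j, x 0 j \is a Num.int) /\ forall p, moduli_lattice (u p).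
    by move: Ly; rewrite -Fwy => /Flat[]; rewrite lw => ? H; split=> // p; rewrite -lu.
  (* Another tangent vector with the same image [y] lies in the lattice; by
     injectivity both have the same class modulo [D]. *)
  have [w' [tw' lw' lu' Lw']] := lift_lattice BA ix iu.
  have Fwy' : F w' = y by apply: xu.
  exists (pi w'); last by rewrite gpi.
  split; first by exists w'.
  move: yS; rewrite /= -img => /memv_imgP[z zS yz]; have [w2 tw2 zE] := SN z zS.
  suff -> : pi w' = z by [].
  rewrite zE; apply/eqP; rewrite -subr_eq0 -linearB; apply/eqP; apply: inj.
    by apply/NP; rewrite rpredB //; apply/NP.
  by rewrite linearB /= Fwy' -gpi -zE -yz subrr.
- move=> sigma rho mS mY _; rewrite (star_weight cM Mtau rx wM mS) Fw //.
Qed.
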